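(* Let $f,t$ be integers with $1\le t\le f$. There is no $f$-resilient $t$-two-step consensus protocol for $3f+2t-2$ processes.
   Context: Model. There are $n$ processes $\Pi=\{p_1,\dots,p_n\}$, each assigned a deterministic algorithm. A process that deviates from its algorithm (arbitrary steps, or stopping prematurely) is Byzantine; the others are correct. Processes communicate over reliable, authenticated point-to-point channels. Each process has a public/private key pair, all public keys are known, and the adversary cannot forge digital signatures of correct processes. The system is partially synchronous: there is a known bound $\Delta$ and an unknown time GST after which every message sent by a correct process to a correct process is received within $\Delta$ time units (messages between correct processes are always eventually received). Processes may have access to perfectly synchronized local clocks showing the time elapsed since the start; local computation time is neglected. Consensus with weak validity. Each process $p$ has an input value from a domain $\mathcal V$ containing at least two values; each correct process may decide at most once. A protocol is an $f$-resilient consensus protocol with weak validity if every infinite execution with at most $f$ Byzantine processes satisfies: Liveness (each correct process eventually decides), Consistency (no two correct processes decide on different values), Weak validity (if all processes are correct and have the same input value, then only this value can be decided on). Executions. An initial configuration is a function $I:\Pi\to\mathcal V$ giving the inputs. An execution is a tuple $(I,\mathcal B,\mathcal S)$ with $I$ an initial configuration, $\mathcal B$ the set of Byzantine processes ($|\mathcal B|\le f$) and $\mathcal S$ a totally ordered sequence of timed steps (''send message'', ''receive message'', ''timer elapsed'') of the processes; it is said to start from $I$. Round $i$ is the time interval $[(i-1)\Delta,i\Delta)$. $\mathcal T$-faulty two-step execution. For $\mathcal T\subset\Pi$ with $|\mathcal T|=t$, an execution $(I,\mathcal B,\mathcal S)$ is a $\mathcal T$-faulty two-step execution iff: (1) $\mathcal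 B=\mathcal T$ (all other processes are correct); (2) all messages sent during round $i$ are delivered precisely at time $i\Delta$; (3) local computation is instantaneous; (4) the processes in $\mathcal T$ correctly follow the protocol with respect to $I$ during the first round and then stop taking any steps (in particular they send no messages at time $\Delta$ or later); (5) every correct process decides no later than at time $2\Delta$. A protocol is $t$-two-step if it is a consensus protocol with weak validity and, for every initial configuration $I$ and every $\mathcal T\subset\Pi$ of size $t$, there is a $\mathcal T$-faulty two-step execution starting from $I$. *)

(* Defs.v *)
From Stdlib Require List.
From mathcomp Require Import all_boot all_order all_algebra.
From mathcomp Require Import reals.

Set Implicit Arguments.
Unset Strict Implicit.
Unset Printing Implicit Defensive.

Import Order.TTheory GRing.Theory Num.Theory.
Local Open Scope ring_scope.

(* Digital signatures are symbolic: [Signed p m] is [m] together with a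
   signature of process [p] on it. *)
Inductive message (n : nat) (D : Type) : Type :=
| Data of D
| Pair of message n D & message n D
| Signed of 'I_n & message n D.

Fixpoint has_signature (n : nat) (D : Type) (p : 'I_n) (c m : message n D)
    : Prop :=
  match m with
  | Data _ => False
  | Pair m1 m2 => has_signature p c m1 \/ has_signature p c m2
  | Signed q m' => (q = p /\ m' = c) \/ has_signature p c m'
  end.

(* The events a process observes: its start, the elapsing of its timer, and
   the reception of a message from an (authenticated) sender. *)
Inductive event (n : nat) (D : Type) : Type :=
| Start
| Timer
| Receive of 'I_n & message n D.
Arguments Start {n D}.
Arguments Timer {n D}.

Definition is_receive (n : nat) (D : Type) (e : event n D) : bool :=
  if e is Receive _ _ then true else false.

(* What a process has seen so far, in order, with the readings of its clock
   (which shows the time elapsed since the start). *)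
Definition history (R : realType) (n : nat) (D : Type) : Type :=
  seq (R * event n D).

(* A deterministic algorithm for each process, as functions of the input and
   of the history up to and including the event just observed:
   - [out] lists the (destination, message) pairs sent at that moment;
   - [alarm] is the clock value at which the timer of the process elapses next,
     unless another event occurs first, in which case it is evaluated anew;
     several timers are encoded by the earliest pending one;
   - [decision] is the value decided at that moment, if any.
   A process signs with its own private key only, so any other signature it
   sends must come from a received message.  The last two fields exclude
   algorithms which block the passage of time: a timer is never set in the
   past, and never elapses infinitely often within bounded time without any
   other event occurring in between. *)
Record protocol (R : realType) (n : nat) (V : Type) : Type := Protocol {
  data : Type;
  out : 'I_n -> V -> history R n data -> seq ('I_n * message n data);
  alarm : 'I_n -> V -> history R n data -> option R;
  decision : 'I_n -> V -> history R n data -> option V;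
  out_signatures :
    forall p v h q m r c, List.In (q, m) (out p v h) ->
      has_signature r c m -> r <> p ->
      exists tau q' m',
        List.In (tau, Receive q' m') h /\ has_signature r c m';
  alarm_ge :
    forall p v h tau e a, alarm p v (rcons h (tau, e)) = Some a -> tau <= a;
  alarm_diverges :
    forall p v (h : nat -> history R n data) (a : nat -> R),
      (forall k, alarm p v (h k) = Some (a k) /\
                 h k.+1 = rcons (h k) (a k, Timer)) ->
      forall M : R, exists k, M < a k
}.

(* An atomic step: [proc] observes [ev] at time [time] and immediately
   sends [sends]. *)
Record step (R : realType) (n : nat) (D : Type) : Type := Step {
  time : R;
  proc : 'I_n;
  ev : event n D;
  sends : seq ('I_n * message n D)
}.

(* [None] entries are padding, so that executions in which only finitely many
   steps are ever taken are covered as well.  A sent message is identified by a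
   pair (index of the sending step, position in its list [sends]);
   if step [k] is a reception, [origin k] is the message it receives. *)
Record execution (R : realType) (n : nat) (V D : Type) : Type := Execution {
  init : 'I_n -> V;
  byz : {set 'I_n};
  steps : nat -> option (step R n D);
  origin : nat -> nat * nat
}.

Section Executions.
Context {R : realType} {n : nat} {V D : Type}.
Implicit Type E : execution R n V D.

Definition history_before E (p : 'I_n) (k : nat) : history R n D :=
  pmap (fun j => if steps E j is Some s then
                   if proc s == p then Some (time s, ev s) else None
                 else None) (iota 0 k).

Definition sent E (id : nat * nat) (s : step R n D) (q : 'I_n)
    (m : message n D) : Prop :=
  steps E id.1 = Some s /\ onth (sends s) id.2 = Some (q, m).

Definition received E (id : nat * nat) (k : nat) (s : step R n D) : Prop :=
  [/\ steps E k = Some s, is_receive (ev s) & origin E k = id].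

(* Times are ordered, and infinite executions run forever: only finitely many
   steps are taken within bounded time. *)
Definition well_timed E : Prop :=
  [/\ forall k s, steps E k = Some s -> 0 <= time s,
      forall j k s s', (j <= k)%N -> steps E j = Some s ->
        steps E k = Some s' -> time s <= time s'
    & forall M : R, exists K, forall k s,
        (K <= k)%N -> steps E k = Some s -> M < time s].

(* Only messages that were sent are received, from their actual sender, and
   at most once. *)
Definition authenticated_channels E : Prop :=
  (forall k s q m, steps E k = Some s -> ev s = Receive q m ->
     ((origin E k).1 < k)%N /\
     exists s', sent E (origin E k) s' (proc s) m /\ proc s' = q) /\
  (forall id j k s s', received E id j s -> received E id k s' -> j = k).

(* Byzantine processes collude, but a signature of a correct process
   is available to them only once one of them has received it. *)
Definition unforgeable_signatures E : Prop :=
  forall k i s q m r c,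
    sent E (k, i) s q m -> proc s \in byz E ->
    has_signature r c m -> r \notin byz E ->
    exists j s' q' m',
      [/\ (j <= k)%N, steps E j = Some s', proc s' \in byz E,
          ev s' = Receive q' m' & has_signature r c m'].

Definition partially_synchronous (Delta : R) E : Prop :=
  exists GST : R, forall id s q m,
    sent E id s q m -> proc s \notin byz E -> q \notin byz E ->
    exists k s', received E id k s' /\
      (GST <= time s -> time s' <= time s + Delta).

End Executions.

Section Protocols.
Context {R : realType} {n : nat} {V : Type}.
Variable P : protocol R n V.
Implicit Type E : execution R n V (data P).

Definition decides E (p : 'I_n) (k : nat) (s : step R n (data P)) (v : V)
    : Prop :=
  [/\ steps E k = Some s, proc s = p
    & decision p (init E p) (rcons (history_before E p k) (time s, ev s))
      = Some v].

(* [p] follows its algorithm at all times satisfying the (downward closed)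
   predicate [H]. *)
Definition follows (H : R -> Prop) E (p : 'I_n) : Prop :=
  [/\ exists k s, steps E k = Some s /\ proc s = p,
      forall k s, steps E k = Some s -> proc s = p -> H (time s) ->
        let h := history_before E p k in
        sends s = out p (init E p) (rcons h (time s, ev s)) /\
        match ev s with
        | Start => h = [::] /\ time s = 0
        | Timer => h <> [::] /\ alarm p (init E p) h = Some (time s)
        | Receive _ _ => h <> [::]
        end
    & forall k s a, steps E k = Some s -> proc s = p ->
        alarm p (init E p) (rcons (history_before E p k) (time s, ev s))
          = Some a ->
        H a ->
        exists k' s', [/\ (k < k')%N, steps E k' = Some s', proc s' = p
                        & time s' <= a]].

(* The infinite executions of the protocol with at most [f] Byzantine
   processes. *)
Definition admissible (f : nat) (Delta : R) E : Prop :=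
  [/\ (#|byz E| <= f)%N,
      well_timed E,
      authenticated_channels E /\ unforgeable_signatures E,
      forall p, p \notin byz E -> follows (fun _ => True) E p
    & partially_synchronous Delta E].

Definition liveness E : Prop :=
  forall p, p \notin byz E -> exists k s v, decides E p k s v.

Definition decides_at_most_once E : Prop :=
  forall p k s v k' s' v', p \notin byz E ->
    decides E p k s v -> decides E p k' s' v' -> k = k'.

Definition consistency E : Prop :=
  forall p q k s v k' s' v', p \notin byz E -> q \notin byz E ->
    decides E p k s v -> decides E q k' s' v' -> v = v'.

Definition weak_validity E : Prop :=
  forall v, byz E = set0 -> (forall p, init E p = v) ->
    forall p k s w, decides E p k s w -> w = v.

Definition weak_consensus (f : nat) (Delta : R) : Prop :=
  forall E, admissible f Delta E ->
    [/\ liveness E, decides_at_most_once E, consistency E & weak_validity E].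

(* Messages sent in round i + 1, i.e. during [i Delta, (i + 1) Delta),
   are delivered exactly at time (i + 1) Delta; those addressed to a process
   of [T] give rise to no step, as it has stopped by then. *)
Definition lockstep (T : {set 'I_n}) (Delta : R) E : Prop :=
  forall id s q m (i : nat),
    sent E id s q m -> i%:R * Delta <= time s < i.+1%:R * Delta ->
    (forall k s', received E id k s' -> time s' = i.+1%:R * Delta) /\
    (q \notin T -> exists k s', received E id k s').

Definition two_step_execution (f : nat) (Delta : R) (T : {set 'I_n}) E : Prop :=
  [/\ admissible f Delta E /\ byz E = T,
      lockstep T Delta E,
      forall p, p \in T -> follows (fun tau => tau < Delta) E p,
      forall k s, steps E k = Some s -> proc s \in T -> time s < Delta
    & forall p, p \notin T ->
        exists k s v, decides E p k s v /\ time s <= 2 * Delta].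

(* [f]-resilient [t]-two-step consensus protocol *)
Definition two_step_consensus (f t : nat) (Delta : R) : Prop :=
  weak_consensus f Delta /\
  forall (I : 'I_n -> V) (T : {set 'I_n}), #|T| = t ->
    exists E, init E = I /\ two_step_execution f Delta T E.

End Protocols.

(* Main.v *)
Require Import Defs.
From mathcomp Require Import all_boot all_order all_algebra.
From mathcomp Require Import boolp reals zify lra.
Import Order.TTheory GRing.Theory Num.Theory.
Local Open Scope ring_scope.

Set Implicit Arguments.
Unset Strict Implicit.
Unset Printing Implicit Defensive.

(* Walking from the all-[x] to the all-[y] initial configuration, one input at a
   time, some process [p] is influential: two fast executions [alpha false] and
   [alpha true], whose inputs differ only at [p] and whose silent sets [T false]
   and [T true] are disjoint and avoid [p], decide differently.  The remaining
   3(f - 1) processes are split into three groups [G false], [B], [G true] of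
   size f - 1.  In the first round only [p] behaves differently in the two
   executions, so a Byzantine [p] can make [G false] and [T true] run two rounds
   as in [alpha false], and [G true] and [T false] as in [alpha true].  If [p]
   and [B] are Byzantine and fall silent, the others eventually decide some [v].
   If instead [p] and [G (~~ b)] are Byzantine and show [B] the behaviour of
   [alpha b], then [B] decides the value of [alpha b] after two rounds, while
   the others, not hearing from [B], still decide [v].  Hence [v] is the value
   of both [alpha false] and [alpha true].  When f = 1 the groups are empty, and
   [p] directly makes [T true] and [T false] decide differently.

   Executions are assembled from the local histories of virtual processes, all
   of which run the protocol honestly.  A Byzantine process may be played by two
   of them, the real one [(q, true)] and the phantom [(q, false)], each with its
   own input and its own view of the world. *)

(** * Merging the local histories of virtual processes *)

Section Local.
Variables (R : realType) (n : nat) (V : Type) (P : protocol R n V).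

Definition vproc : Type := 'I_n * bool.
(* A sent message is named by its sender, the index of the sending entry in the
   sender's local history, and the position in the list sent there. *)
Definition source : Type := vproc * nat * nat.
Definition entry : Type := (R * event n (data P)) * source.

Definition hist_of (s : seq (option entry)) : history R n (data P) :=
  pmap (omap fst) s.

Lemma hist_of_cat s1 s2 : hist_of (s1 ++ s2) = hist_of s1 ++ hist_of s2.
Proof. exact: pmap_cat. Qed.

(** This is the part of [follows] that can be checked on the history of one process. By the last
    clause no event may happen after a pending alarm: the timer would have elapsed first. *)
Definition legal_next (q : 'I_n) (v : V) (h : history R n (data P))
    (x : R * event n (data P)) : Prop :=
  [/\ match x.2 with
      | Start => h = [::] /\ x.1 = 0
      | Timer => h <> [::] /\ alarm q v h = Some x.1
      | Receive _ _ => h <> [::]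
      end,
      forall h' y, h = rcons h' y -> y.1 <= x.1
    & forall a, h <> [::] -> alarm q v h = Some a -> x.1 <= a].

End Local.

Lemma In_rcons (T : Type) (x y : T) s :
  List.In x (rcons s y) -> List.In x s \/ x = y.
Proof.
elim: s => [|z s IH] /=; first by case=> // ->; right.
by case=> [->|/IH[]]; [left; left | left; right | right].
Qed.

Section Merge.
Variables (R : realType) (n : nat) (V : Type) (P : protocol R n V).
Local Notation vproc := (vproc n).
Local Notation entry := (entry P).
Variables (L : vproc -> nat -> option entry) (inp : vproc -> V).
Variables (F : {set 'I_n}) (f : nat) (Delta : R).

Definition past j i := hist_of (mkseq (L j) i).
Definition entry_sends j i : seq ('I_n * message n (data P)) :=
  if L j i is Some e then out j.1 (inp j) (rcons (past j i) e.1) else [::].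

Hypothesis F_le : (#|F| <= f)%N.
Hypothesis L_legal : forall j i e, L j i = Some e ->
  legal_next j.1 (inp j) (past j i) e.1.
Hypothesis L_div : forall M, exists K, forall j i e, (K <= i)%N ->
  L j i = Some e -> M < e.1.1.
Hypothesis L_src : forall (j : vproc) i tau q m j' i' pos, j.2 ->
  L j i = Some ((tau, Receive q m), (j', i', pos)) ->
  j'.1 = q /\ exists e', [/\ L j' i' = Some e', e'.1.1 < tau
    & onth (entry_sends j' i') pos = Some (j.1, m)].
Hypothesis L_inj : forall (j : vproc) i1 i2 e1 e2, j.2 ->
  L j i1 = Some e1 -> L j i2 = Some e2 ->
  is_receive e1.1.2 -> is_receive e2.1.2 -> e1.2 = e2.2 -> i1 = i2.
(** Receptions of phantoms vanish from the merged execution. Any signature of a correct process that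
    a phantom learns must therefore also have reached a real Byzantine process, no later. *)
Hypothesis L_phantom : forall (j : vproc) i tau q m src r c, ~~ j.2 ->
  L j i = Some ((tau, Receive q m), src) -> has_signature r c m -> r \notin F ->
  exists (j' : vproc) i' tau' q' m' src', [/\ j'.2, j'.1 \in F,
    L j' i' = Some ((tau', Receive q' m'), src'), tau' <= tau
    & has_signature r c m'].
Hypothesis L_byz : forall (j : vproc) i e, ~~ j.2 -> L j i = Some e -> j.1 \in F.
Hypothesis L_start : forall q, q \notin F -> exists i e, L (q, true) i = Some e.
Hypothesis L_alarm : forall q i e a, q \notin F -> L (q, true) i = Some e ->
  alarm q (inp (q, true)) (rcons (past (q, true) i) e.1) = Some a ->
  exists i' e', (i < i')%N /\ L (q, true) i' = Some e'.
Hypothesis L_sync : exists GST, forall (j : vproc) i e q pos m, j.2 -> j.1 \notin F ->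
  q \notin F -> L j i = Some e -> onth (entry_sends j i) pos = Some (q, m) ->
  exists i' e', [/\ L (q, true) i' = Some e', is_receive e'.1.2,
    e'.2 = (j, i, pos) & GST <= e.1.1 -> e'.1.1 <= e.1.1 + Delta].

Lemma past_S j i :
  past j i.+1 = if L j i is Some e then rcons (past j i) e.1 else past j i.
Proof.
rewrite /past /hist_of /mkseq -addn1 iotaD map_cat pmap_cat add0n /=.
by case: (L j i) => [e|] /=; rewrite ?cats1 ?cats0.
Qed.

Lemma past_last j i k e : (i < k)%N -> L j i = Some e ->
  exists h y, past j k = rcons h y /\ e.1.1 <= y.1.
Proof.
elim: k => // k IH; rewrite ltnS leq_eqVlt => /orP[/eqP-> Le|ik Le].
  by exists (past j k), e.1; rewrite past_S Le.
have [h [y [hy ey]]] := IH ik Le.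
rewrite past_S; case Lk: (L j k) => [e'|]; last by exists h, y.
exists (past j k), e'.1; split=> //; apply: le_trans ey _.
by have [_ + _] := L_legal Lk; apply; exact: hy.
Qed.

Lemma L_mono j i k e e' : (i < k)%N -> L j i = Some e -> L j k = Some e' ->
  e.1.1 <= e'.1.1.
Proof.
move=> ik Li Lk; have [h [y [hy ey]]] := past_last ik Li.
by apply: le_trans ey _; have [_ + _] := L_legal Lk; apply; exact: hy.
Qed.

(** An empty history admits only [Start], at time 0, and local times never decrease afterwards. *)
Lemma time_ge0 j i e : L j i = Some e -> 0 <= e.1.1.
Proof.
have [k] := ubnP i; elim: k i e => // k IH i e; rewrite ltnS => ik Li.
have [past0|past_n] := pselect (past j i = [::]).
  have [ev _ _] := L_legal Li; move: ev.
  by case: e.1.2 => [|| q m]; rewrite past0; [case=> _ -> | case | ].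
have [i' [e' [lti' Li']]] : exists i' e', (i' < i)%N /\ L j i' = Some e'.
  elim: i past_n {ik Li} => // i IHi.
  rewrite past_S; case Li: (L j i) => [e'|]; first by exists i, e'.
  by move=> /IHi[i' [e' [lti Li']]]; exists i', e'; rewrite ltnS ltnW.
apply: le_trans (L_mono lti' Li' Li).
by apply: IH Li'; apply: leq_trans ik.
Qed.

Definition event_time (a : vproc * nat) : R :=
  if L a.1 a.2 is Some e then e.1.1 else 0.

(** Breaks ties between simultaneous events. Real processes precede all phantoms, so a signature
    received at the same moment by a real Byzantine process and by a phantom is available when the
    phantom uses it. *)
Definition priority (j : vproc) : nat := (~~ j.2 * #|{: vproc}| + enum_rank j)%N.

Lemma priority_inj : injective priority.
Proof.
move=> [q1 b1] [q2 b2]; rewrite /priority => eq12.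
have [r1 r2] := (ltn_ord (enum_rank (q1, b1)), ltn_ord (enum_rank (q2, b2))).
apply: enum_rank_inj; apply: val_inj.
move: eq12 r1 r2; case: b1 => /=; case: b2 => /=;
  rewrite ?mul0n ?mul1n ?add0n.
- by [].
- by move=> ->; rewrite -ltn_subRL subnn.
- by move=> <- _; rewrite -ltn_subRL subnn.
- by move/addnI.
Qed.

Lemma priority_real_phantom (j j' : vproc) : j.2 -> ~~ j'.2 ->
  (priority j < priority j')%N.
Proof.
rewrite /priority => -> ->; rewrite mul0n mul1n add0n.
exact: leq_trans (ltn_ord _) (leq_addr _ _).
Qed.

(** The lexicographic order on time, priority and local index. The first component must be an actual
    entry, so that padding is never counted by [rank]. *)
Definition before (a b : vproc * nat) : bool :=
  L a.1 a.2 &&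
  ((event_time a < event_time b) || (event_time a == event_time b) &&
    ((priority a.1 < priority b.1)%N || (a.1 == b.1) && (a.2 < b.2)%N)).

Lemma before_irr a : before a a = false.
Proof. by rewrite /before ltxx !ltnn !andbF. Qed.

Lemma before_trans b a c : before a b -> before b c -> before a c.
Proof.
rewrite /before => /andP[-> ab] /andP[_] /=.
case/orP: ab => [ab|/andP[/eqP-> ab]].
  by case/orP=> [bc|/andP[/eqP<- _]]; rewrite ?ab // (lt_trans ab bc).
case/orP=> [->//|/andP[-> bc]]; apply/orP; right => /=.
case/orP: ab => [ab|/andP[/eqP-> ab]].
  by case/orP: bc => [bc|/andP[/eqP<- _]]; rewrite ?ab // (ltn_trans ab bc).
by case/orP: bc => [->//|/andP[-> bc]]; rewrite (ltn_trans ab bc) orbT.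
Qed.

Lemma before_total a b : L a.1 a.2 -> L b.1 b.2 -> a != b ->
  before a b || before b a.
Proof.
move=> La Lb; apply: contraNT; rewrite negb_or /before La Lb /=.
case: (ltgtP (event_time a) (event_time b)) => //= _.
case: (ltngtP (priority a.1) (priority b.1)) => //=; rewrite ?andbF // => /priority_inj eq1.
rewrite eq1 eqxx /=; case: (ltngtP a.2 b.2) => //= eq2 _.
by rewrite [a]surjective_pairing [b]surjective_pairing eq1 eq2.
Qed.

Lemma before_local j i k : (i < k)%N -> L j i -> L j k ->
  before (j, i) (j, k).
Proof.
move=> ik Li Lk; rewrite /before /= Li eqxx ik orbT andbT /event_time /=.
case Ei: (L j i) Li => [e|] // _; case Ek: (L j k) Lk => [e'|] // _.
by have := L_mono ik Ei Ek; rewrite le_eqVlt orbC.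
Qed.

Definition horizon (M : R) : nat := projT1 (cid (L_div M)).

(** The global position of an event: the number of events before it. The inner sum is finite
    because, by [L_div], all entries from index [horizon] on are too late to precede [a]. *)
Definition rank (a : vproc * nat) : nat :=
  (\sum_(j : vproc) \sum_(0 <= i < horizon (event_time a)) before (j, i) a)%N.

(** Nothing beyond the horizon precedes [a]; hence two ranks can be compared by counting over one
    common range. *)
Lemma rankE N a : (horizon (event_time a) <= N)%N ->
  rank a = (\sum_(j : vproc) \sum_(0 <= i < N) before (j, i) a)%N.
Proof.
move=> leN; apply: eq_bigr => j _; rewrite [RHS](big_cat_nat _ leN) //=.
rewrite [X in (_ + X)%N]big1_seq ?addn0 // => i /andP[_].
rewrite mem_index_iota => /andP[lei _].
rewrite /before /=; case Li: (L j i) => [e|] //=.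
have := projT2 (cid (L_div (event_time a))) _ _ _ lei Li.
by rewrite /event_time /= Li; case: ltgtP.
Qed.

Lemma rank_mono a b : before a b -> (rank a < rank b)%N.
Proof.
move=> ab; have La : L a.1 a.2 by case/andP: ab.
pose N := maxn a.2.+1 (maxn (horizon (event_time a)) (horizon (event_time b))).
rewrite (@rankE N a) ?(@rankE N b) /N; try by rewrite !leq_max leqnn ?orbT.
rewrite -/N; apply: (@leq_trans (\sum_(j : vproc) \sum_(0 <= i < N)
   (before (j, i) a + ((j, i) == a)))%N).
  under [X in (_ <= X)%N]eq_bigr => j _ do rewrite big_split /=.
  rewrite big_split /= -addn1 leq_add2l (bigD1 a.1) //= big_mkord.
  have ltN : (a.2 < N)%N by rewrite !leq_max leqnn.
  by rewrite (bigD1 (Ordinal ltN)) //= -surjective_pairing eqxx -addnA.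
apply: leq_sum => j _; apply: leq_sum => i _.
case: eqP => [->|_]; first by rewrite before_irr ab.
by case ca: (before (j, i) a) => //; rewrite (before_trans ca ab).
Qed.

Lemma rank_inj a b : L a.1 a.2 -> L b.1 b.2 -> rank a = rank b -> a = b.
Proof.
move=> La Lb eq_ab; apply/eqP/negP => /negP/(before_total La Lb).
by case/orP=> /rank_mono; rewrite eq_ab ltnn.
Qed.

Lemma rank_lt a b : L a.1 a.2 -> L b.1 b.2 -> (rank a < rank b)%N -> before a b.
Proof.
move=> La Lb lt_ab; have /(before_total La Lb)/orP[//|/rank_mono] : a != b.
  by apply: contraTneq lt_ab => ->; rewrite ltnn.
by rewrite ltnNge ltnW.
Qed.

(** The partial inverse of [rank]. Numbers that are not ranks become padding steps of the merged
    execution. *)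
Definition at_rank (k : nat) : option (vproc * nat) :=
  if pselect (exists a, L a.1 a.2 /\ rank a = k) is left pf
  then Some (projT1 (cid pf)) else None.

Lemma at_rankK a : L a.1 a.2 -> at_rank (rank a) = Some a.
Proof.
move=> La; rewrite /at_rank; case: pselect => [pf|[]]; last by exists a.
by case: (cid _) => /= b [Lb /(rank_inj Lb La) ->].
Qed.

Lemma at_rankP k a : at_rank k = Some a -> L a.1 a.2 /\ rank a = k.
Proof.
by rewrite /at_rank; case: pselect => // pf [<-]; case: (cid _).
Qed.

(* The receptions of phantoms are fictitious: they are turned into timer events,
   which are unconstrained for Byzantine processes. *)
Definition step_of (a : vproc * nat) (e : entry) : step R n (data P) :=
  Step e.1.1 a.1.1 (if ~~ a.1.2 && is_receive e.1.2 then Timer else e.1.2)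
    (entry_sends a.1 a.2).

Definition merge : execution R n V (data P) :=
  Execution (fun q => inp (q, true)) F
    (fun k => if at_rank k is Some a then omap (step_of a) (L a.1 a.2) else None)
    (fun k => if at_rank k is Some a then
                if L a.1 a.2 is Some e then (rank e.2.1, e.2.2) else (0, 0)%N
              else (0, 0)%N).

Lemma merge_step a e : L a.1 a.2 = Some e ->
  steps merge (rank a) = Some (step_of a e) /\
  origin merge (rank a) = (rank e.2.1, e.2.2).
Proof. by move=> La; rewrite /= at_rankK ?La //= La. Qed.

Lemma merge_stepP k s : steps merge k = Some s ->
  exists a e, [/\ L a.1 a.2 = Some e, rank a = k & s = step_of a e].
Proof.
rewrite /=; case atk: (at_rank k) => [a|] //; have [La ak] := at_rankP atk.
by case Le: (L a.1 a.2) => [e|] //= [<-]; exists a, e.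
Qed.

Lemma pmap_isSome (A B : Type) (phi : A -> option B) s :
  pmap phi s = pmap phi [seq x <- s | phi x].
Proof.
elim: s => //= x s ->; case phix: (phi x) => [y|] //=.
by rewrite phix.
Qed.

(** By [L_byz] a correct process has no phantom, so its steps are exactly its real entries, and
    [rank] keeps them in order. *)
Lemma merge_history q i : q \notin F -> L (q, true) i ->
  history_before merge q (rank ((q, true), i)) = past (q, true) i.
Proof.
move=> qF Li; pose j : vproc := (q, true).
rewrite /history_before; set phi := (X in pmap X _).
have phiP i' : L j i' -> phi (rank (j, i')) = omap fst (L j i').
  case Li': (L j i') => [[[tau x] src]|] // _; rewrite /phi.
  by have [-> _] := @merge_step (j, i') _ Li'; rewrite /= eqxx.
have -> : past j i = pmap (omap fst \o L j) (iota 0 i).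
  by rewrite /past /hist_of /mkseq; elim: (iota 0 i) => //= ? ? ->.
rewrite pmap_isSome [RHS]pmap_isSome.
(* Both lists of positions are strictly increasing, so it suffices that they have the same
   members. *)
have -> : [seq k <- iota 0 (rank (j, i)) | phi k] =
    [seq rank (j, i') | i' <- iota 0 i & (omap fst \o L j) i'].
  have sorted_iota m k : sorted ltn (iota m k) by exact: iota_ltn_sorted.
  apply: (irr_sorted_eq ltn_trans ltnn).
  - exact: (sorted_filter ltn_trans).
  - have srt := sorted_filter ltn_trans (omap fst \o L j) (sorted_iota 0%N i).
    apply: homo_sorted_in srt; first last.
    + exact: filter_all.
    + move=> i1 i2; rewrite !unfold_in /= => Li1 Li2 lt12.
      have [Lj1 Lj2] : L j i1 /\ L j i2.
        by split; [case: (L j i1) Li1|case: (L j i2) Li2].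
      exact/rank_mono/before_local.
  - move=> k; rewrite mem_filter mem_iota add0n /=; apply/andP/mapP.
    + rewrite /phi => -[]; case stk: (steps merge k) => [s|] //.
      case: eqP => // procs _ ltk.
      have [[[q' b] i'] [e [/= Le ek es]]] := merge_stepP stk.
      move: procs; rewrite es /= => eq'; rewrite {}eq' in Le ek.
      have bT : b by apply: contraNT qF => nb; exact: (@L_byz (q, b) i' e).
      rewrite bT in Le ek; exists i'; last by [].
      rewrite mem_filter /= Le /= mem_iota add0n /=.
      have : before (j, i') (j, i) by apply: rank_lt => //=; rewrite ?Le ?ek.
      case: (ltngtP i' i) => // [lt_ii|->]; last by rewrite before_irr.
      move=> b1; have b2 : before (j, i) (j, i') by apply: before_local; rewrite ?Le.
      by have := before_trans b1 b2; rewrite before_irr.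
    + case=> i'; rewrite mem_filter mem_iota add0n /= => /andP[Li' lti] ->.
      have Lj : L j i' by move: Li'; case: (L j i').
      rewrite phiP //; split; first by case: (L j i') Lj.
      exact/rank_mono/before_local.
elim: (iota 0 i) => //= i' l IH; case Li': (L j i') => [e|] //=.
by rewrite phiP Li' //= IH.
Qed.

Lemma In_past x j k : List.In x (past j k) ->
  exists i src, (i < k)%N /\ L j i = Some (x, src).
Proof.
elim: k => // k IH; rewrite past_S; case Lk: (L j k) => [[y src]|].
  move=> xin; case: (In_rcons xin) => [/IH|->]; last by exists k, src.
  by case=> i [src' [ik Li]]; exists i, src'; rewrite ltnS ltnW.
by case/IH=> i [src [ik Li]]; exists i, src; rewrite ltnS ltnW.
Qed.

Lemma merge_step_correct k s q : q \notin F -> steps merge k = Some s ->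
  proc s = q -> exists i e, [/\ L (q, true) i = Some e, rank (q, true, i) = k
    & s = Step e.1.1 q e.1.2 (entry_sends (q, true) i)].
Proof.
move=> qF /merge_stepP[[[q' b] i] [e [/= Le ek ->]]] /= eq'.
rewrite {}eq' in Le ek *; have bT : b by apply: contraNT qF => nb; exact: L_byz Le.
by rewrite bT in Le ek *; exists i, e.
Qed.

Lemma rank_ltP a b : L a.1 a.2 -> L b.1 b.2 -> (rank a < rank b)%N ->
  event_time a <= event_time b.
Proof.
by move=> La Lb /(rank_lt La Lb) /andP[_ /orP[/ltW //|/andP[/eqP-> _]]].
Qed.

Lemma merge_well_timed : well_timed merge.
Proof.
split.
- by move=> k s /merge_stepP[a [e [/time_ge0 + _ ->]]].
- move=> k1 k2 s1 s2 le12 /merge_stepP[a1 [e1 [L1 eq1 ->]]].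
  move=> /merge_stepP[a2 [e2 [L2 eq2 ->]]].
  have [La1 La2] : L a1.1 a1.2 /\ L a2.1 a2.2 by rewrite L1 L2.
  move: le12; rewrite -eq1 -eq2 leq_eqVlt => /orP[/eqP eqr|ltr].
    by move: L1; rewrite (rank_inj La1 La2 eqr) L2 => -[->].
  by have := rank_ltP La1 La2 ltr; rewrite /event_time L1 L2.
- move=> M; have [K HK] := L_div M.
  (* Only finitely many entries have a local index below [K]; past the largest of their ranks every
     step is later than [M]. *)
  have [K' HK'] : exists K', forall j i, (i < K)%N -> (rank (j, i) < K')%N.
    exists (\max_(x : vproc * 'I_K) rank (x.1, val x.2)).+1 => j i ltK.
    exact: (leq_bigmax (F := fun x : vproc * 'I_K => rank (x.1, val x.2))
      (j, Ordinal ltK)).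
  exists K' => k s leK /merge_stepP[a [e [La ak ->]]] /=; apply: HK La.
  rewrite leqNgt; apply/negP => /(HK' a.1); rewrite -surjective_pairing ak.
  by rewrite ltnNge leK.
Qed.

Lemma merge_receive k s q m : steps merge k = Some s -> ev s = Receive q m ->
  exists (j : vproc) i tau j' i' pos, [/\ j.2, rank (j, i) = k,
    L j i = Some ((tau, Receive q m), (j', i', pos)),
    s = Step tau j.1 (Receive q m) (entry_sends j i)
    & origin merge k = (rank (j', i'), pos)].
Proof.
move=> /merge_stepP[[j i] [[[tau x] [[j' i'] pos]] [/= La ak ->]]].
rewrite /step_of /=; case jT: j.2 => /=; last by case: x La.
move=> ex.
exists j, i, tau, j', i', pos; rewrite -ex; split=> //.
by have [_] := @merge_step (j, i) _ La; rewrite ak.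
Qed.

Lemma merge_channels : authenticated_channels merge.
Proof.
split.
  move=> k s q m stk evs.
  have [j [i [tau [j' [i' [pos [jT jk Lj -> ok]]]]]]] := merge_receive stk evs.
  have [j'q [e' [Le' lt_t snt]]] := L_src jT Lj; rewrite ok; split.
    rewrite -jk; apply: rank_mono; rewrite /before /= Le' /=.
    by rewrite /event_time /= Le' Lj lt_t.
  exists (step_of (j', i') e'); split=> //; split=> //.
  by have [] := @merge_step (j', i') _ Le'.
move=> id k1 k2 s1 s2 [st1 + o1] [st2 + o2].
case ev1: (ev s1) => [|| q1 m1] // _; case ev2: (ev s2) => [|| q2 m2] // _.
have [j1 [i1 [tau1 [j1' [i1' [pos1 [j1T jk1 Lj1 _ ok1]]]]]]] := merge_receive st1 ev1.
have [j2 [i2 [tau2 [j2' [i2' [pos2 [j2T jk2 Lj2 _ ok2]]]]]]] := merge_receive st2 ev2.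
have [_ [e1 [Le1 _ snt1]]] := L_src j1T Lj1.
have [_ [e2 [Le2 _ snt2]]] := L_src j2T Lj2.
have [La1 La2] : L j1' i1' /\ L j2' i2' by rewrite Le1 Le2.
move: ok1; rewrite o1 -o2 ok2 => -[eqr eqp].
have [eqj eqi] : (j2', i2') = (j1', i1') 
  by exact: (@rank_inj (j2', i2') (j1', i1') La2 La1 eqr).
(* The one message has one destination, and both receivers are real, so they are the same virtual
   process and [L_inj] applies. *)
move: snt2; rewrite eqj eqi eqp snt1 => -[eqj12 _].
have ejj : j1 = j2.
  by rewrite [j1]surjective_pairing [j2]surjective_pairing eqj12 j1T j2T.
rewrite -jk1 -jk2; rewrite ejj in Lj1 *; congr (rank (_, _)).
by apply: (L_inj j2T Lj1 Lj2) => //=; rewrite eqj eqi eqp.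
Qed.

Lemma onth_In (T : Type) (s : seq T) i x : onth s i = Some x -> List.In x s.
Proof.
by elim: s i => [|y s IH] [|i] //=; [case=> ->; left | move/IH; right].
Qed.

(** By [out_signatures], a foreign signature comes from a reception in the sender's own past. For a
    real sender this reception is the required step. For a phantom, [L_phantom] supplies a real
    reception, and [priority] places it first even if the times coincide. *)
Lemma merge_signatures : unforgeable_signatures merge.
Proof.
move=> k pos s q m r c [/= stk snt] procF sig rF.
have [[j i] [e [/= Le jk es]]] := merge_stepP stk.
move: procF snt; rewrite es /= => jF snt.
have := onth_In snt; rewrite /entry_sends Le => mout.
have [|tau [q' [m' []]]] := out_signatures mout sig.
  by apply/eqP; apply: contraNneq rF => ->.
have -> : rcons (past j i) e.1 = past j i.+1 by rewrite past_S Le.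
case/In_past=> i' [src [lei Li']] sig'.
have le_ii k' : rank (j, i') = k' -> (k' <= k)%N.
  move=> <-; rewrite -jk; move: lei; rewrite ltnS leq_eqVlt => /orP[/eqP->//|lti].
  by apply/ltnW/rank_mono/before_local => //; rewrite ?Li' ?Le.
case jT: j.2.
  exists (rank (j, i')), (step_of (j, i') (tau, Receive q' m', src)), q', m'.
  split=> //; first exact: le_ii.
    by have [] := @merge_step (j, i') _ Li'.
  by rewrite /= jT.
have [j2 [i2 [tau2 [q2 [m2 [src2 [j2T j2F Lj2 le_t sig2]]]]]]] :=
  L_phantom (negbT jT) Li' sig' rF.
exists (rank (j2, i2)), (step_of (j2, i2) (tau2, Receive q2 m2, src2)), q2, m2.
split=> //; last by rewrite /= j2T.
  apply: leq_trans (le_ii _ erefl); apply/ltnW/rank_mono.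
  rewrite /before /event_time /= Lj2 Li' /= priority_real_phantom ?jT // andbT.
  by rewrite orbC -le_eqVlt.
by have [] := @merge_step (j2, i2) _ Lj2.
Qed.

Lemma merge_follows q : q \notin F -> follows (fun _ => True) merge q.
Proof.
move=> qF; split.
- have [i [e Le]] := L_start qF; exists (rank (q, true, i)).
  by have [-> _] := @merge_step (q, true, i) _ Le; eexists.
- move=> k s stk procs _; have [i [e [Le <- ->]]] := merge_step_correct qF stk procs.
  rewrite /= merge_history ?Le // /entry_sends Le; split.
    by rewrite -surjective_pairing.
  by have [+ _ _] := L_legal Le; case: e.1.2.
- move=> k s a stk procs; have [i [e [Le <- ->]]] := merge_step_correct qF stk procs.
  rewrite /= merge_history ?Le // -surjective_pairing => al _.
  have [i' [e' [ltii Le']]] := L_alarm qF Le al.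
  (* The first actual entry after [i] still has the history ending with entry [i], so [legal_next]
     bounds its time by the alarm. *)
  have exi : exists i', (i < i')%N && L (q, true) i'.
    by exists i'; rewrite ltii Le'.
  case: (ex_minnP exi) => i2 /andP[lt2]; case Le2: (L (q, true) i2) => [e2|] // _ min2.
  exists (rank (q, true, i2)), (step_of (q, true, i2) e2); split=> //.
  + by apply/rank_mono/before_local; rewrite ?Le ?Le2.
  + by have [] := @merge_step (q, true, i2) _ Le2.
  have past2 d : (i.+1 + d <= i2)%N -> past (q, true) (i.+1 + d) = rcons (past (q, true) i) e.1.
    elim: d => [|d IH]; first by rewrite addn0 past_S Le.
    rewrite addnS => ltd; rewrite past_S IH; last exact: ltnW.
    case Led: (L _ _) => [ed|] //.
    have := min2 (i.+1 + d)%N; rewrite Led andbT addSn ltnS leq_addr => /(_ isT).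
    by rewrite leqNgt -addSn ltd.
  have [_ _] := L_legal Le2; rewrite -(subnKC lt2) past2 ?subnKC //=.
  by apply=> //; case: (past _ _).
Qed.

Lemma merge_synchronous : partially_synchronous Delta merge.
Proof.
have [GST HG] := L_sync; exists GST => id s q m [stk snt] procF qF.
have [i [e [Le ei es]]] := merge_step_correct procF stk erefl.
move: snt; rewrite es /= => snt.
have [i' [e' [Le' rc src tm]]] := HG (proc s, true) i e q id.2 m isT procF qF Le snt.
exists (rank (q, true, i')), (step_of (q, true, i') e').
have [st' o'] := @merge_step (q, true, i') _ Le'.
by split=> //; split=> //; rewrite o' src /= ei -surjective_pairing.
Qed.

Lemma merge_admissible : admissible f Delta merge.
Proof.
split.
- exact: F_le.
- exact: merge_well_timed.
- split; [exact: merge_channels | exact: merge_signatures].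
- exact: merge_follows.
- exact: merge_synchronous.
Qed.

Lemma merge_decides q v : q \notin F ->
  (exists k s, decides merge q k s v) <->
  (exists i e, L (q, true) i = Some e /\
    decision q (inp (q, true)) (rcons (past (q, true) i) e.1) = Some v).
Proof.
move=> qF; split=> [[k [s [stk procs]]]|[i [e [Le dec]]]].
  have [i [e [Le <- ->]]] := merge_step_correct qF stk procs.
  by rewrite /= merge_history ?Le // -surjective_pairing; exists i, e.
exists (rank (q, true, i)), (step_of (q, true, i) e); split=> //.
  by have [] := @merge_step (q, true, i) _ Le.
by rewrite /= merge_history ?Le // -surjective_pairing.
Qed.

Lemma merge_execution : exists E : execution R n V (data P),
  [/\ admissible f Delta E, byz E = F, init E = (fun q => inp (q, true))
    & forall q v, q \notin F ->
        (exists k s, decides E q k s v) <->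
        (exists i e, L (q, true) i = Some e /\
          decision q (inp (q, true)) (rcons (past (q, true) i) e.1) = Some v)].
Proof. by exists merge; split=> //; [exact: merge_admissible | exact: merge_decides]. Qed.

End Merge.

(** * Continuing a finite prefix round by round *)

Section Rounds.
Variables (R : realType) (n : nat) (V : Type) (P : protocol R n V).
Local Notation vproc := (vproc n).
Local Notation source := (source n).
Local Notation entry := (entry P).
Local Notation history := (history R n (data P)).
Variable inp : vproc -> V.

Definition legal_seq (j : vproc) (s : seq (option entry)) : Prop :=
  forall i e, nth None s i = Some e ->
    legal_next j.1 (inp j) (hist_of (take i s)) e.1.

Definition times_le (M : R) (s : seq (option entry)) : Prop :=
  forall i e, nth None s i = Some e -> e.1.1 <= M.

Definition times_ge (M : R) (s : seq (option entry)) : Prop :=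
  forall i e, nth None s i = Some e -> M <= e.1.1.

Lemma times_le_cat M s t : times_le M s -> times_le M t -> times_le M (s ++ t).
Proof. by move=> Ms Mt i e; rewrite nth_cat; case: ifP => _; [exact: Ms|exact: Mt]. Qed.

Lemma In_hist_of y (s : seq (option entry)) : List.In y (hist_of s) ->
  exists i e, nth None s i = Some e /\ e.1 = y.
Proof.
elim: s => [|[e|] s IH] //=.
  case=> [<-|/IH[i [e' [nthi ey]]]]; first by exists 0%N, e.
  by exists i.+1, e'.
by case/IH=> i [e' [nthi ey]]; exists i.+1, e'.
Qed.

Lemma hist_of_rcons (s : seq (option entry)) x : hist_of (rcons s x) =
  if x is Some e then rcons (hist_of s) e.1 else hist_of s.
Proof. by rewrite -cats1 hist_of_cat /=; case: x => [e|] /=; rewrite ?cats1 ?cats0. Qed.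

Lemma legal_rcons j s x : legal_seq j s ->
  (forall e, x = Some e -> legal_next j.1 (inp j) (hist_of s) e.1) ->
  legal_seq j (rcons s x).
Proof.
move=> leg legx i e; rewrite nth_rcons -cats1.
case: ltnP => [lti|gei]; first by rewrite takel_cat ?(ltnW lti) //; exact: leg.
by case: eqP => // -> /legx; rewrite take_size_cat.
Qed.

Section Tick.
Variables (q : 'I_n) (v : V).

Definition tick (h : history) : history :=
  if alarm q v h is Some a then rcons h (a, Timer) else h.

Lemma tickE h a : alarm q v h = Some a -> tick h = rcons h (a, Timer).
Proof. by rewrite /tick => ->. Qed.

Definition idle_until (M : R) (h : history) : bool :=
  if alarm q v h is Some a then M < a else true.

(** Otherwise the timer would elapse infinitely often up to time [M], against [alarm_diverges]. *)
Lemma ticks_idle M h : exists k, idle_until M (iter k tick h).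
Proof.
apply: contrapT => never.
have al k : exists2 a, alarm q v (iter k tick h) = Some a & a <= M.
  have : ~ idle_until M (iter k tick h) by move=> idl; apply: never; exists k.
  rewrite /idle_until; case: alarm => [a|] // /negP; rewrite -leNgt => leM.
  by exists a.
pose a k := odflt 0 (alarm q v (iter k tick h)).
have [k|k] := alarm_diverges (p := q) (v := v) (h := fun k => iter k tick h) (a := a) _ M.
  by rewrite iterS /a; have [b eb _] := al k; rewrite (tickE eb) eb.
by rewrite /a; have [b -> leb] := al k; rewrite ltNge leb.
Qed.

Definition tick_count M h : nat := ex_minn (ticks_idle M h).

End Tick.

Fixpoint timers (j : vproc) k (h : history) : seq (option entry) :=
  if k is k'.+1 then
    if alarm j.1 (inp j) h is Some a then
      Some ((a, Timer), (j, 0, 0)%N) :: timers j k' (rcons h (a, Timer))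
    else [::]
  else [::].

(** [lo] is any lower bound on the alarm pending at the outset. By [alarm_ge] every later alarm
    inherits it, so all added events lie between [lo] and [M]. *)
Lemma timers_legal j k (s : seq (option entry)) lo M :
  (forall k', (k' < k)%N ->
    ~~ idle_until j.1 (inp j) M (iter k' (tick j.1 (inp j)) (hist_of s))) ->
  idle_until j.1 (inp j) M (iter k (tick j.1 (inp j)) (hist_of s)) ->
  legal_seq j s -> hist_of s <> [::] ->
  (forall a, alarm j.1 (inp j) (hist_of s) = Some a -> lo <= a) ->
  let t := timers j k (hist_of s) in
  [/\ legal_seq j (s ++ t), times_le M t, times_ge lo t, hist_of (s ++ t) <> [::] &
    (forall a, alarm j.1 (inp j) (hist_of (s ++ t)) = Some a -> M <= a) /\
    forall i e, nth None t i = Some e -> ~~ is_receive e.1.2].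
Proof.
elim: k s => [|k IH] s busy idl leg nnil lo_al /=.
  rewrite cats0; split=> //; try by move=> i e; rewrite nth_nil.
  split; last by move=> i e; rewrite nth_nil.
  by move=> a al; move: idl; rewrite /= /idle_until al => /ltW.
have := busy 0%N isT; rewrite /= {1}/idle_until.
case al: (alarm j.1 (inp j) (hist_of s)) => [a|] //; rewrite -leNgt => leM.
pose x : option entry := Some ((a, Timer), (j, 0, 0)%N).
have hx : hist_of (rcons s x) = rcons (hist_of s) (a, Timer) by rewrite hist_of_rcons.
have tx : hist_of (rcons s x) = tick j.1 (inp j) (hist_of s) by rewrite hx /tick al.
rewrite -hx -cat_rcons.
have [||||b|l1 l2 l3 l4 [l5 l6]] := IH (rcons s x).
- by move=> k' lek; rewrite tx -iterSr; exact: busy.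
- by rewrite tx -iterSr.
- apply: legal_rcons => // e [<-] /=; split=> //=.
  + by move=> h' [y1 y2] hy; move: al; rewrite hy; exact: alarm_ge.
  + by move=> b _; rewrite al => -[->].
- by rewrite hx; case: (hist_of s).
- rewrite hx => al'; apply: le_trans (alarm_ge al'); exact: lo_al.
split=> //.
- by case=> [|i] e /=; [case=> <- | exact: l2].
- by case=> [|i] e /=; [case=> <-; exact: lo_al | exact: l3].
- by split=> // -[|i] e /=; [case=> <- | exact: l6].
Qed.

(** All receptions happen at the single time [M], and an alarm set at [M] is never earlier than [M],
    so none of them passes a pending alarm. *)
Lemma receptions_legal j (s t : seq (option entry)) M :
  (forall i e, nth None t i = Some e -> e.1.1 = M /\ is_receive e.1.2) ->
  legal_seq j s -> hist_of s <> [::] -> times_le M s ->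
  (forall a, alarm j.1 (inp j) (hist_of s) = Some a -> M <= a) ->
  [/\ legal_seq j (s ++ t), hist_of (s ++ t) <> [::]
    & forall a, alarm j.1 (inp j) (hist_of (s ++ t)) = Some a -> M <= a].
Proof.
elim: t s => [|x t IH] s tP leg nnil times al; first by rewrite cats0.
rewrite -cat_rcons; apply: IH => //.
- by move=> i; exact: (tP i.+1).
- apply: legal_rcons => // e xe; have := tP 0%N e xe.
  case: e xe => [[tau [|| q m]] src] /= xe [-> //] _; split=> //=.
  + move=> h' y hy; have : List.In y (hist_of s).
      by rewrite hy -cats1; elim: h' {hy} => [|z h' IHh] /=; [left | right].
    by case/In_hist_of=> i [e [nthi <-]]; exact: times nthi.
  + by move=> a _ /al.
- by rewrite hist_of_rcons; case: x tP => // e _; case: (hist_of s).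
- by rewrite -cats1; apply: times_le_cat => // -[|i] e /= xe; rewrite ?nth_nil // in xe *;
    have [-> _] := tP 0%N e xe.
- rewrite hist_of_rcons; case: x tP => // -[[tau ev] src] tP a.
  by have [/= <- _] := tP 0%N _ erefl; exact: alarm_ge.
Qed.

Definition sources_of (s : seq (option entry)) : seq source :=
  pmap (fun x => if x is Some (_, Receive _ _, src) then Some src else None) s.

Lemma sources_of_cat s t : sources_of (s ++ t) = sources_of s ++ sources_of t.
Proof. exact: pmap_cat. Qed.

Lemma mem_sources_of (s : seq (option entry)) src : reflect
  (exists i e, [/\ nth None s i = Some e, is_receive e.1.2 & e.2 = src])
  (src \in sources_of s).
Proof.
apply: (iffP idP).
  elim: s => [|x s IH] //=; have tl : src \in sources_of s -> exists i e,
    [/\ nth None (x :: s) i = Some e, is_receive e.1.2 & e.2 = src].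
    by case/IH=> i [e es]; exists i.+1, e.
  case: x tl => [[[tau [|| q m]] src']|] tl //=; rewrite inE.
  by case/orP=> [/eqP->|//]; exists 0%N, (tau, Receive q m, src').
case=> i [e []]; elim: s i e => [|x s IH] [|i] e //=.
  by move=> -> /=; case: e => [[tau [|| q m]] src'] //= _ ->; rewrite inE eqxx.
move=> nthi rc es; have := IH i e nthi rc es.
by case: x => [[[tau [|| q m]] src']|] //= h; rewrite inE h orbT.
Qed.

Lemma uniq_sources_of (s : seq (option entry)) i1 i2 e1 e2 :
  uniq (sources_of s) -> nth None s i1 = Some e1 -> nth None s i2 = Some e2 ->
  is_receive e1.1.2 -> is_receive e2.1.2 -> e1.2 = e2.2 -> i1 = i2.
Proof.
elim: s i1 i2 e1 e2 => [|x s IH] [|i1] [|i2] e1 e2 //= un n1 n2 r1 r2 eqs.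
- case: e1 n1 r1 eqs un => [[tau [|| q m]] src] //= -> _ /= eqs /andP[/mem_sources_of[]].
  by exists i2, e2.
- case: e2 n2 r2 eqs un => [[tau [|| q m]] src] //= -> _ /= eqs /andP[/mem_sources_of[]].
  by exists i1, e1.
congr _.+1; apply: (IH _ _ e1 e2) => //; move: un.
by case: x => [[[tau [|| q m]] src]|] //= /andP[].
Qed.

Definition sends_at j (s : seq (option entry)) i : seq ('I_n * message n (data P)) :=
  if nth None s i is Some e then
    out j.1 (inp j) (rcons (hist_of (take i s)) e.1)
  else [::].

Definition state : Type := vproc -> seq (option entry).

Definition sent_at (X : state) (id : source) : option ('I_n * message n (data P)) :=
  onth (sends_at id.1.1 (X id.1.1) id.1.2) id.2.

Definition all_sent (d : rel vproc) (X : state) (j : vproc) : seq source :=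
  flatten [seq flatten [seq [seq (a, i, pos) |
      pos <- iota 0 (size (sends_at a (X a) i))] | i <- iota 0 (size (X a))]
    | a <- enum {: vproc} & d a j].

Definition addressed (X : state) (j : vproc) (id : source) : bool :=
  if sent_at X id is Some (q, _) then q == j.1 else false.

Definition pending (d : rel vproc) (X : state) (j : vproc) : seq source :=
  undup [seq id <- all_sent d X j |
    addressed X j id & id \notin sources_of (X j)].

Definition reception (X : state) (tau : R) (id : source) : option entry :=
  omap (fun qm => (tau, Receive id.1.1.1 qm.2, id)) (sent_at X id).

Variables (F : {set 'I_n}) (f : nat) (Delta H : R).
Variables (X0 : state) (act : pred vproc) (dlv : nat -> rel vproc).

(** With rounds of length [Delta / 4], a message sent in one round and delivered at the end of the
    next arrives well within [Delta]. *)
Definition round_time (r : nat) : R := H + r%:R * (Delta / 4%:R).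

(* Only messages sent in previous rounds are delivered, so that every reception
   happens strictly later than the corresponding sending. *)
Definition advance (r : nat) (X : state) : state := fun j =>
  if act j then
    X j ++ timers j (tick_count j.1 (inp j) (round_time r.+1) (hist_of (X j)))
             (hist_of (X j))
        ++ rcons [seq reception X (round_time r.+1) id | id <- pending (dlv r) X j]
             None
  else rcons (X j) None.

Fixpoint stage (r : nat) : state := if r is r'.+1 then advance r' (stage r') else X0.

(** Every round appends at least one [None], so [stage i.+1 j] has more than [i] entries, and later
    rounds leave entry [i] unchanged. *)
Definition limit (j : vproc) (i : nat) : option entry := nth None (stage i.+1 j) i.

Lemma stage_cat r d j : exists t, stage (r + d) j = stage r j ++ t.
Proof.
elim: d => [|d [t IH]]; first by exists [::]; rewrite addn0 cats0.
rewrite addnS /= /advance; case: (act j); last by rewrite IH -cats1 -catA; eexists.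
by rewrite {1}IH -catA; eexists.
Qed.

Lemma size_stage r j : (r <= size (stage r j))%N.
Proof.
elim: r => // r IH /=; rewrite /advance; case: (act j).
  by rewrite !size_cat size_rcons; lia.
by rewrite size_rcons.
Qed.

Lemma limit_stage r j i : (i < size (stage r j))%N ->
  limit j i = nth None (stage r j) i.
Proof.
move=> lti; rewrite /limit; case: (leqP r i.+1) => [le_r|lt_r].
  by have [t] := stage_cat r (i.+1 - r) j; rewrite subnKC // => ->; rewrite nth_cat lti.
have [t] := stage_cat i.+1 (r - i.+1) j; rewrite subnKC; last exact: ltnW.
by move=> ->; rewrite nth_cat size_stage.
Qed.

Lemma nth_stage r j i e : nth None (stage r j) i = Some e -> limit j i = Some e.
Proof.
move=> nthi; rewrite (limit_stage (r := r)) //.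
by rewrite ltnNge; apply/negP => /(nth_default None); rewrite nthi.
Qed.

Lemma past_stage r j i : (i <= size (stage r j))%N ->
  past limit j i = hist_of (take i (stage r j)).
Proof.
move=> lei; rewrite /past; congr hist_of.
apply: (@eq_from_nth _ None); first by rewrite size_mkseq size_takel.
move=> k; rewrite size_mkseq => ltk; rewrite nth_mkseq // nth_take //.
by apply: limit_stage; apply: leq_trans ltk lei.
Qed.

Lemma sends_stage r j i : (i < size (stage r j))%N ->
  entry_sends limit inp j i = sends_at j (stage r j) i.
Proof.
move=> lti; rewrite /entry_sends /sends_at (limit_stage lti).
by case: nth => // e; rewrite (past_stage (ltnW lti)).
Qed.

Hypothesis Delta_gt0 : 0 < Delta.
Hypothesis F_le : (#|F| <= f)%N.
Hypothesis X0_legal : forall j, legal_seq j (X0 j).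
Hypothesis X0_le : forall j, times_le H (X0 j).
Hypothesis X0_src : forall (j : vproc) i tau q m j' i' pos, j.2 ->
  nth None (X0 j) i = Some ((tau, Receive q m), (j', i', pos)) ->
  j'.1 = q /\ exists e', [/\ nth None (X0 j') i' = Some e', e'.1.1 < tau
    & onth (sends_at j' (X0 j') i') pos = Some (j.1, m)].
Hypothesis X0_uniq : forall j : vproc, j.2 -> uniq (sources_of (X0 j)).
Hypothesis X0_phantom : forall (j : vproc) i tau q m src r c, ~~ j.2 ->
  nth None (X0 j) i = Some ((tau, Receive q m), src) ->
  has_signature r c m -> r \notin F ->
  exists (j' : vproc) i' tau' q' m' src', [/\ j'.2, j'.1 \in F,
    nth None (X0 j') i' = Some ((tau', Receive q' m'), src'), tau' <= tau
    & has_signature r c m'].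
Hypothesis X0_byz : forall (j : vproc) i e,
  ~~ j.2 -> nth None (X0 j) i = Some e -> j.1 \in F.
(** Phantoms stop with the prefix, so their receptions have to be justified only there. *)
Hypothesis act_real : forall j : vproc, act j -> j.2.
Hypothesis act_start : forall j : vproc, act j -> hist_of (X0 j) <> [::].
Hypothesis act_correct : forall q, q \notin F -> act (q, true).
(** Deliveries may be withheld arbitrarily before round [N]; this [N] determines the stabilization
    time. *)
Hypothesis dlv_fair : exists N, forall r (j : vproc) q, (N <= r)%N -> j.2 ->
  j.1 \notin F -> q \notin F -> dlv r j (q, true).

Lemma round_timeS r : round_time r.+1 = round_time r + Delta / 4%:R.
Proof. by rewrite /round_time -natr1 mulrDl mul1r addrA. Qed.

Lemma round_time_lt r : round_time r < round_time r.+1.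
Proof. by rewrite round_timeS ltrDl divr_gt0. Qed.

Lemma round_time_le r d : round_time r <= round_time (r + d).
Proof.
elim: d => [|d IH]; first by rewrite addn0.
by rewrite addnS; apply: le_trans IH (ltW (round_time_lt _)).
Qed.

Lemma round_time_unbounded M : exists r, M < round_time r.
Proof.
have D4 : 0 < Delta / 4%:R by rewrite divr_gt0.
exists (Num.bound (`|M - H| / (Delta / 4%:R))).
have := archi_boundP (x := `|M - H| / (Delta / 4%:R)).
rewrite divr_ge0 ?normr_ge0 ?(ltW D4) // => /(_ isT); rewrite ltr_pdivrMr // => lt1.
by rewrite /round_time -ltrBlDl; apply: le_lt_trans lt1; exact: ler_norm.
Qed.

Lemma nth_receptions X tau (l : seq source) i e :
  nth None (rcons [seq reception X tau id | id <- l] None) i = Some e ->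
  exists2 id, id \in l & reception X tau id = Some e.
Proof.
rewrite nth_rcons size_map; case: ltnP => [lti|_]; last by case: eqP.
rewrite (nth_map e.2) // => rec; exists (nth e.2 l i) => //.
exact: mem_nth.
Qed.

Lemma receptionE X tau id e : reception X tau id = Some e ->
  [/\ e.1.1 = tau, is_receive e.1.2 & e.2 = id].
Proof. by rewrite /reception; case: (sent_at X id) => //= qm [<-]. Qed.

Lemma ticks_busy (q : 'I_n) (v : V) M h k : (k < tick_count q v M h)%N ->
  ~~ idle_until q v M (iter k (tick q v) h).
Proof.
rewrite /tick_count; case: ex_minnP => m _ minm ltk; apply/negP => /minm.
by rewrite leqNgt ltk.
Qed.

Lemma ticks_done (q : 'I_n) (v : V) M h :
  idle_until q v M (iter (tick_count q v M h) (tick q v) h).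
Proof. by rewrite /tick_count; case: ex_minnP. Qed.

(** The bound on alarms starts with stage 1: a process whose prefix was cut off early may have an
    alarm pending before [H]. Such alarms are worked off in the first round, at their proper
    times. *)
Lemma stage_inv r j :
  [/\ legal_seq j (stage r j), times_le (round_time r) (stage r j),
      act j -> hist_of (stage r j) <> [::]
    & act j -> (0 < r)%N -> forall a,
        alarm j.1 (inp j) (hist_of (stage r j)) = Some a -> round_time r <= a].
Proof.
elim: r => [|r [leg le_t nnil al]] /=.
  split=> //; last by move=> /act_start.
  by rewrite /round_time mul0r addr0; exact: X0_le.
have le_S t : times_le (round_time r) t -> times_le (round_time r.+1) t.
  by move=> h i e /h /le_trans; apply; apply/ltW/round_time_lt.
rewrite /advance; case: ifP => [aj|_]; last first.
  split=> //; first exact: legal_rcons.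
  by rewrite -cats1; apply: times_le_cat; [exact: le_S | case=> [|[]]].
set h := hist_of (stage r j); set k := tick_count _ _ _ _.
pose lo := odflt 0 (alarm j.1 (inp j) h).
have [|||l1 l2 _ l3 [l4 _]] := @timers_legal j k (stage r j) lo (round_time r.+1)
    _ _ leg (nnil aj).
- by move=> k'; exact: ticks_busy.
- exact: ticks_done.
- by move=> a; rewrite /lo /h => ->.
have le1 := times_le_cat (le_S _ le_t) l2.
set t2 := rcons _ _.
have t2P i e : nth None t2 i = Some e -> e.1.1 = round_time r.+1 /\ is_receive e.1.2.
  by case/nth_receptions=> id _ /receptionE[].
have [l5 l6 l7] := receptions_legal t2P l1 l3 le1 l4.
rewrite catA; split=> //; apply: times_le_cat => //.
by move=> i e /t2P[-> _].
Qed.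

Lemma stage_low r j i e : (0 < r)%N -> (size (stage r j) <= i)%N ->
  nth None (stage r.+1 j) i = Some e -> round_time r <= e.1.1.
Proof.
move=> r_gt0 lei /=; have [leg le_t nnil al] := stage_inv r j.
rewrite /advance; case: ifP => [aj|_]; last first.
  by rewrite nth_rcons ltnNge lei /=; case: eqP.
rewrite nth_cat ltnNge lei /=; move: (i - _)%N => {lei}i.
set h := hist_of (stage r j); set k := tick_count _ _ _ _.
have [||_ _ l2 _ _] := @timers_legal j k (stage r j) (round_time r) (round_time r.+1)
    _ _ leg (nnil aj) (al aj r_gt0).
- by move=> k'; exact: ticks_busy.
- exact: ticks_done.
rewrite nth_cat; case: ifP => _; first exact: l2.
by case/nth_receptions=> id _ /receptionE[-> _ _]; apply/ltW/round_time_lt.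
Qed.

Lemma limit_low r j i e : (0 < r)%N -> (size (stage r j) <= i)%N ->
  limit j i = Some e -> round_time r <= e.1.1.
Proof.
move=> r_gt0 lei Le.
have [d] : exists d, (i < size (stage (r + d) j))%N.
  by exists i.+1; apply: leq_trans (size_stage _ _); rewrite leq_addl.
elim: d => [|d IH] ltd; first by move: ltd; rewrite addn0 ltnNge lei.
case: (ltnP i (size (stage (r + d) j))) => [/IH //|ged].
apply: le_trans (round_time_le r d) _.
apply: (stage_low (j := j) (i := i)) => //; first by rewrite addn_gt0 r_gt0.
by rewrite -addnS -limit_stage.
Qed.

Lemma stage_uniq r (j : vproc) : j.2 -> uniq (sources_of (stage r j)).
Proof.
move=> jT; elim: r => [|r IH] /=; first exact: X0_uniq.
have [leg le_t nnil al] := stage_inv r j.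
rewrite /advance; case: ifP => [aj|_]; last first.
  by rewrite -cats1 sources_of_cat cats0.
set h := hist_of (stage r j); set k := tick_count _ _ _ _.
pose lo := odflt 0 (alarm j.1 (inp j) h).
have [|||_ _ _ _ [_ l5]] := @timers_legal j k (stage r j) lo (round_time r.+1)
    _ _ leg (nnil aj).
- by move=> k'; exact: ticks_busy.
- exact: ticks_done.
- by move=> a; rewrite /lo /h => ->.
rewrite !sources_of_cat.
have -> : sources_of (timers j k h) = [::].
  move: l5; rewrite -/h; elim: (timers j k h) => // x t IHt l5 /=.
  rewrite /sources_of /= -/(sources_of t) IHt; last by move=> i; exact: (l5 i.+1).
  by case: x l5 => [[[tau [|| q m]] src]|] //= /(_ 0%N _ erefl).
rewrite -cats1 sources_of_cat cats0 /=.
set l := pending _ _ _; have un : uniq l by exact: undup_uniq.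
have disj id : id \in l -> id \notin sources_of (stage r j).
  by rewrite mem_undup mem_filter => /andP[/andP[]].
have -> : sources_of [seq reception (stage r) (round_time r.+1) id | id <- l] =
    [seq id <- l | sent_at (stage r) id].
  elim: l {un disj} => //= id l; rewrite /sources_of /reception /= => ->.
  by case: (sent_at _ _).
rewrite cat_uniq IH filter_uniq // andbT /=.
by apply/hasPn => id; rewrite mem_filter => /andP[_ /disj].
Qed.

Lemma reception_origin j i e : limit j i = Some e -> is_receive e.1.2 ->
  nth None (X0 j) i = Some e \/
  exists r m, [/\ e.1 = (round_time r.+1, Receive e.2.1.1.1 m)
    & sent_at (stage r) e.2 = Some (j.1, m)].
Proof.
move=> Le rc; have: nth None (stage i.+1 j) i = Some e by [].
elim: (i.+1) => [|r IH] /=; first by left.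
have [leg le_t nnil al] := stage_inv r j.
rewrite /advance; case: ifP => [aj|_]; last first.
  by rewrite nth_rcons; case: ifP => _ //; case: eqP.
rewrite nth_cat; case: ifP => _; first exact: IH.
move: (i - _)%N => i2; rewrite nth_cat; case: ifP => _.
  set h := hist_of (stage r j); set k := tick_count _ _ _ _.
  pose lo := odflt 0 (alarm j.1 (inp j) h).
  have [|||_ _ _ _ [_ l5]] := @timers_legal j k (stage r j) lo (round_time r.+1)
    _ _ leg (nnil aj).
  - by move=> k'; exact: ticks_busy.
  - exact: ticks_done.
  - by move=> a; rewrite /lo /h => ->.
  by move/l5; rewrite rc.
case/nth_receptions=> id; rewrite mem_undup mem_filter => /andP[/andP[adr _] _].
move: adr; rewrite /addressed /reception; case snt: (sent_at _ id) => [[q m]|] //=.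
by move=> /eqP qj [<-]; rewrite qj in snt; right; exists r, m.
Qed.

Lemma sent_atP X (id : source) qm : sent_at X id = Some qm ->
  exists e, nth None (X id.1.1) id.1.2 = Some e.
Proof.
rewrite /sent_at /sends_at; case: (nth None _ id.1.2) => [e _|]; first by exists e.
by rewrite onth_default.
Qed.

Lemma nth_Some_lt (T : Type) (s : seq (option T)) i e :
  nth None s i = Some e -> (i < size s)%N.
Proof. by rewrite ltnNge => h; apply/negP => /(nth_default None); rewrite h. Qed.

Lemma limit_src (j : vproc) i tau q m j' i' pos : j.2 ->
  limit j i = Some ((tau, Receive q m), (j', i', pos)) ->
  j'.1 = q /\ exists e', [/\ limit j' i' = Some e', e'.1.1 < tau
    & onth (entry_sends limit inp j' i') pos = Some (j.1, m)].
Proof.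
move=> jT /[dup] Le /reception_origin /(_ isT) [|[r [m' [/= [-> <- <-] snt]]]].
  case/(X0_src jT) => jq [e' [Le' lt_t snt]]; split=> //; exists e'.
  split=> //; first exact: (nth_stage (r := 0)).
  by rewrite (sends_stage (r := 0)) //; exact: nth_Some_lt Le'.
split=> //; have [e' /= Le'] := sent_atP snt; exists e'; split.
- exact: nth_stage Le'.
- have [_ le_t _ _] := stage_inv r j'.
  exact: le_lt_trans (le_t _ _ Le') (round_time_lt r).
- by rewrite (sends_stage (r := r)) //; exact: nth_Some_lt Le'.
Qed.

Lemma id_received r (j : vproc) i pos q m : dlv r j (q, true) -> act (q, true) ->
  onth (sends_at j (stage r j) i) pos = Some (q, m) ->
  (j, i, pos) \in sources_of (stage r.+1 (q, true)).
Proof.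
move=> dj aq snt /=; rewrite /advance aq !sources_of_cat !mem_cat.
set id := (j, i, pos); case: (boolP (id \in sources_of (stage r (q, true)))) => //= nin.
apply/orP; right; rewrite -cats1 sources_of_cat cats0.
set l := pending _ _ _.
have sid : sent_at (stage r) id = Some (q, m) by [].
have idl : id \in l.
  rewrite mem_undup mem_filter /addressed sid eqxx nin /=.
  apply/flattenP; exists (flatten [seq [seq (j, i, pos) |
      pos <- iota 0 (size (sends_at j (stage r j) i))] | i <- iota 0 (size (stage r j))]).
    by apply/mapP; exists j => //; rewrite mem_filter dj mem_enum.
  apply/flattenP; exists [seq (j, i, pos) |
      pos <- iota 0 (size (sends_at j (stage r j) i))].
    apply/mapP; exists i => //; rewrite mem_iota /= add0n.
    by have [e] := sent_atP sid; exact: nth_Some_lt.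
  apply/mapP; exists pos => //; rewrite mem_iota /= add0n ltnNge.
  by apply/negP => /onth_default; rewrite snt.
apply/mem_sources_of; exists (index id l).
rewrite (nth_map id) ?index_mem // nth_index // /reception sid /=.
by eexists; split.
Qed.

Definition decides_in (X : state) (q : 'I_n) (v : V) : Prop :=
  exists i e, nth None (X (q, true)) i = Some e /\
    decision q (inp (q, true)) (rcons (hist_of (take i (X (q, true)))) e.1) = Some v.

Lemma rounds_execution : exists E : execution R n V (data P),
  [/\ admissible f Delta E, byz E = F, init E = (fun q => inp (q, true))
    & forall q v, q \notin F ->
        (exists k s, decides E q k s v) <-> (exists r, decides_in (stage r) q v)].
Proof.
have pastE j i e : limit j i = Some e -> past limit j i = hist_of (take i (stage i.+1 j)).
  by move=> Le; apply: past_stage; apply/ltnW/size_stage.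
have [] := @merge_execution R n V P limit inp F f Delta F_le.
- move=> j i e Le; rewrite (pastE _ _ _ Le).
  by have [leg _ _ _] := stage_inv i.+1 j; exact: leg.
- move=> M; have [r ltM] := round_time_unbounded M.
  exists (\max_(j : vproc) size (stage r.+1 j)) => j i e lei Le.
  apply: lt_trans ltM _; apply: lt_le_trans (round_time_lt r) _.
  apply: limit_low Le => //; apply: leq_trans lei.
  exact: (leq_bigmax (F := fun j => size (stage r.+1 j))).
- exact: limit_src.
- move=> j i1 i2 e1 e2 jT L1 L2.
  have lt1 : (i1 < size (stage (i1 + i2).+1 j))%N.
    by apply: leq_trans (size_stage _ _); lia.
  have lt2 : (i2 < size (stage (i1 + i2).+1 j))%N.
    by apply: leq_trans (size_stage _ _); lia.
  by apply: (uniq_sources_of (stage_uniq (i1 + i2).+1 jT)); rewrite -limit_stage.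
- move=> j i tau q m src r c jF.
  move=> /[dup] Le /reception_origin /(_ isT) [Le0 sig rF|[r' [m' [/= _]]]].
    have [j' [i' [tau' [q' [m' [src' [H1 H2 H3 H4 H5]]]]]]] := X0_phantom jF Le0 sig rF.
    by exists j', i', tau', q', m', src'; split=> //; exact: (nth_stage (r := 0)).
  have [d Le2] : exists d, nth None (stage d j) i = Some (tau, Receive q m, src).
    by exists i.+1.
  have njact : ~~ act j by apply: contraNN jF => /act_real.
  have Le0 : nth None (X0 j) i = Some (tau, Receive q m, src).
    elim: d Le2 => // d IH /=; rewrite /advance (negPf njact) nth_rcons.
    by case: ifP => [_ /IH //|_]; case: eqP.
  move=> _ sig rF.
  have [j' [i' [tau' [q' [m2 [src' [H1 H2 H3 H4 H5]]]]]]] := X0_phantom jF Le0 sig rF.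
  by exists j', i', tau', q', m2, src'; split=> //; exact: (nth_stage (r := 0)).
- move=> j i e jF Le; apply: (X0_byz (i := i) (e := e) jF).
  have njact : ~~ act j by apply: contraNN jF => /act_real.
  move: Le; rewrite /limit; elim: i.+1 => // d IH /=; rewrite /advance (negPf njact).
  by rewrite nth_rcons; case: ifP => [_ /IH //|_]; case: eqP.
- move=> q /act_correct /act_start.
  have : forall s : seq (option entry), hist_of s <> [::] ->
      exists i e, nth None s i = Some e.
    elim=> [|[e|] s IH] //= h; first by exists 0%N, e.
    by have [i [e se]] := IH h; exists i.+1, e.
  move=> ex /ex [i [e Le]]; exists i, e; exact: (nth_stage (r := 0)).
(* Without a later entry, the alarm [a] would still be pending at a stage whose round time exceeds
   [a], which [stage_inv] excludes. *)
- move=> q i e a qF Le al; apply: contrapT => none.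
  have [r1 lt1] := round_time_unbounded a.
  pose r := (r1 + i.+1)%N.
  have lti : (i.+1 <= size (stage r (q, true)))%N.
    by apply: leq_trans (size_stage _ _); rewrite leq_addl.
  have [_ _ _ /(_ (act_correct qF))] := stage_inv r (q, true).
  have r_gt0 : (0 < r)%N by rewrite /r addnS.
  move/(_ r_gt0 a); have -> : hist_of (stage r (q, true)) =
      rcons (past limit (q, true) i) e.1.
    rewrite (past_stage (r := r)); last exact: ltnW.
    rewrite -[in LHS](cat_take_drop i.+1 (stage r (q, true))) hist_of_cat.
    have -> : hist_of (drop i.+1 (stage r (q, true))) = [::].
      have dropN k : nth None (drop i.+1 (stage r (q, true))) k = None.
        rewrite nth_drop; case E: (nth _ _ _) => [e'|] //; case: none.
        by exists (i.+1 + k)%N, e'; rewrite ltnS leq_addr; split; last exact: nth_stage E.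
      elim: (drop _ _) dropN => //= x s IH sN.
      by have /= -> := sN 0%N; rewrite /= IH // => k; exact: (sN k.+1).
    rewrite cats0 (take_nth None) // hist_of_rcons.
    by rewrite -limit_stage // Le.
  move=> /(_ al); rewrite leNgt => /negP; apply.
  exact: lt_le_trans lt1 (round_time_le _ _).
(* A sending at or after [round_time N.+2] first appears in a stage beyond [N.+1], where delivery is
   already fair. Earlier messages also arrive, without a bound on the delay. *)
- have [N fair] := dlv_fair; exists (round_time N.+2) => j i e q pos m jT jF qF Le.
  have get r : (N <= r)%N -> (i < size (stage r j))%N ->
      onth (entry_sends limit inp j i) pos = Some (q, m) ->
      exists i' e', [/\ limit (q, true) i' = Some e', is_receive e'.1.2,
        e'.2 = (j, i, pos) & e'.1.1 <= round_time r.+1].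
    move=> leN lti; rewrite (sends_stage lti).
    move/(id_received (fair _ _ _ leN jT jF qF) (act_correct qF)).
    case/mem_sources_of=> i' [e' [Le' rc src]]; exists i', e'; split=> //.
      exact: nth_stage Le'.
    by have [_ le_t _ _] := stage_inv r.+1 (q, true); exact: le_t Le'.
  have exr : exists r, (i < size (stage r j))%N.
    by exists i.+1; exact: size_stage.
  case: (ex_minnP exr) => r lti minr snt.
  have [late|early] := boolP (round_time N.+2 <= e.1.1); last first.
    have [||i' [e' [H1 H2 H3 _]]] := get (maxn N i.+1) _ _ snt.
    - exact: leq_maxl.
    - by apply: leq_trans (size_stage _ _); exact: leq_maxr.
    by exists i', e'; split=> //; rewrite (negPf early).
  have le_er : e.1.1 <= round_time r.
    have [_ le_t _ _] := stage_inv r j; apply: (le_t i).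
    by rewrite -limit_stage.
  have ltr : (N.+1 < r)%N.
    rewrite ltnNge; apply/negP => le_r.
    have := le_trans late le_er; rewrite leNgt => /negP; apply.
    by rewrite -(subnKC le_r); apply: le_lt_trans (round_time_le r _) (round_time_lt _).
  have [|i' [e' [H1 H2 H3 H4]]] := get r _ lti snt; first by lia.
  exists i', e'; split=> // _; apply: le_trans H4 _.
  (* Minimality of the stage puts the sending at the beginning of its last round or later, and the
     delivery comes at most two rounds, hence [Delta / 2], afterwards. *)
  case: r ltr {lti le_er H3 get} minr => // r ltr minr.
  have : round_time r <= e.1.1.
    apply: limit_low Le; first by lia.
    by rewrite leqNgt; apply/negP => /minr; rewrite ltnn.
  by rewrite !round_timeS => h; have := Delta_gt0; lra.
move=> E [adm bE iE decE]; exists E; split=> // q v qF; rewrite decE //.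
split=> [[i [e [Le dec]]]|[r [i [e [Le dec]]]]].
  by exists i.+1, i, e; rewrite -(pastE _ _ _ Le).
exists i, e; split; first exact: nth_stage Le.
by rewrite (past_stage (r := r)) //; apply/ltnW; exact: nth_Some_lt Le.
Qed.

End Rounds.

(** * Indistinguishability of two continuations *)

Section Agreement.
Variables (R : realType) (n : nat) (V : Type) (P : protocol R n V).
Local Notation vproc := (vproc n).
Variables (inp : vproc -> V) (Delta H : R) (core : pred vproc) (N : nat).
Variables (X Y : state P) (act act' : pred vproc) (dlv dlv' : nat -> rel vproc).
Variable inp' : vproc -> V.

(** Up to round [N] the processes of [core] hear only from [core], and there the prefixes, inputs,
    activity and deliveries coincide. The differences outside therefore cannot reach them. *)
Lemma stage_agree :
  (forall j, core j -> inp j = inp' j) ->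
  (forall j, core j -> X j = Y j) ->
  (forall j, core j -> act j = act' j) ->
  (forall r a j, (r < N)%N -> core j -> dlv r a j -> core a) ->
  (forall r a j, (r < N)%N -> core j -> dlv r a j = dlv' r a j) ->
  forall r j, (r <= N)%N -> core j ->
    stage inp Delta H X act dlv r j = stage inp' Delta H Y act' dlv' r j.
Proof.
move=> inpE XE actE dlv_core dlvE; elim=> [|r IH] j leN cj /=; first exact: XE.
set X1 := stage _ _ _ _ _ _ _ in IH *; set Y1 := stage _ _ _ _ _ _ _ in IH *.
have IH' a : core a -> X1 a = Y1 a by apply: IH; exact: ltnW.
rewrite /advance actE // IH' //; case: ifP => // _; rewrite inpE //.
have timersE k h : timers inp j k h = timers inp' j k h.
  by elim: k h => //= k IHk h; rewrite inpE //; case: alarm => // a; rewrite IHk.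
rewrite timersE; congr (_ ++ (_ ++ rcons _ _)).
have sendsE a i : core a -> sends_at inp a (X1 a) i = sends_at inp' a (Y1 a) i.
  by move=> ca; rewrite /sends_at IH' // inpE.
have sentE (id : source n) : core id.1.1 -> sent_at inp X1 id = sent_at inp' Y1 id.
  by move=> ca; rewrite /sent_at sendsE.
have allE : all_sent inp (dlv r) X1 j = all_sent inp' (dlv' r) Y1 j.
  rewrite /all_sent (eq_filter (a2 := fun a => dlv' r a j)); last first.
    by move=> a; rewrite dlvE.
  congr flatten; apply/eq_in_map => a; rewrite mem_filter -dlvE // => /andP[da _].
  have ca := dlv_core _ _ _ leN cj da.
  rewrite IH' //; congr flatten; apply/eq_in_map => i _.
  by have := sendsE a i ca; rewrite IH' // => ->.
have all_core id : id \in all_sent inp (dlv r) X1 j -> core id.1.1.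
  case/flattenP=> s1 /mapP[a]; rewrite mem_filter => /andP[da _] ->.
  case/flattenP=> s2 /mapP[i _ ->] /mapP[pos _ ->] /=.
  exact: dlv_core leN cj da.
have pendE : pending inp (dlv r) X1 j = pending inp' (dlv' r) Y1 j.
  rewrite /pending -allE; congr undup; apply: eq_in_filter => id /all_core ci.
  by rewrite /addressed sentE // IH'.
rewrite -pendE; apply/eq_in_map => id; rewrite mem_undup mem_filter => /andP[_ /all_core ci].
by rewrite /reception sentE.
Qed.

End Agreement.

(** * Local histories of an execution *)

Section Histories.
Variables (R : realType) (n : nat) (V : Type) (P : protocol R n V).
Local Notation vproc := (vproc n).
Local Notation entry := (entry P).
Variable E : execution R n V (data P).

Lemma history_beforeS q k : history_before E q k.+1 =
  if steps E k is Some s then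
    if proc s == q then rcons (history_before E q k) (time s, ev s)
    else history_before E q k
  else history_before E q k.
Proof.
rewrite /history_before -addn1 iotaD pmap_cat add0n /=.
case: (steps E k) => [s|] /=; last by rewrite cats0.
by case: ifP => _ /=; rewrite ?cats1 ?cats0.
Qed.

Lemma size_history_le q k d :
  (size (history_before E q k) <= size (history_before E q (k + d)))%N.
Proof.
elim: d => [|d IH]; first by rewrite addn0.
rewrite addnS history_beforeS; case: (steps E _) => // s; case: ifP => _ //.
by rewrite size_rcons ltnW.
Qed.

Lemma size_history_lt q k1 k2 s : (k1 < k2)%N -> steps E k1 = Some s ->
  proc s = q -> (size (history_before E q k1) < size (history_before E q k2))%N.
Proof.
move=> lt12 st ps; have := size_history_le q k1.+1 (k2 - k1.+1).
by rewrite subnKC // history_beforeS st ps eqxx size_rcons.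
Qed.

Lemma size_history_inj q k1 k2 s1 s2 : steps E k1 = Some s1 -> proc s1 = q ->
  steps E k2 = Some s2 -> proc s2 = q ->
  size (history_before E q k1) = size (history_before E q k2) -> k1 = k2.
Proof.
move=> st1 p1 st2 p2 eqs; case: (ltngtP k1 k2) => // lt.
  by have := size_history_lt lt st1 p1; rewrite eqs ltnn.
by have := size_history_lt lt st2 p2; rewrite eqs ltnn.
Qed.

Lemma In_history x q k : List.In x (history_before E q k) ->
  exists k' s, [/\ (k' < k)%N, steps E k' = Some s, proc s = q & x = (time s, ev s)].
Proof.
elim: k => // k IH; rewrite history_beforeS.
have up : List.In x (history_before E q k) -> exists k' s,
    [/\ (k' < k.+1)%N, steps E k' = Some s, proc s = q & x = (time s, ev s)].
  by case/IH=> k' [s [ltk ? ? ?]]; exists k', s; split=> //; exact: ltnW.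
case st: (steps E k) => [s|] //; case: eqP => // ps xin.
by case: (In_rcons xin) => [/up //|->]; exists k, s.
Qed.

Lemma history_last q k : history_before E q k = [::] \/
  exists k0 s0, [/\ (k0 < k)%N, steps E k0 = Some s0, proc s0 = q,
    history_before E q k = rcons (history_before E q k0) (time s0, ev s0)
    & forall k' s', (k0 < k')%N -> steps E k' = Some s' -> proc s' = q ->
        (k <= k')%N].
Proof.
elim: k => [|k IH]; first by left.
rewrite history_beforeS; case st: (steps E k) => [s|].
  case: eqP => [ps|nps]; first by right; exists k, s.
  case: IH => [->|[k0 [s0 [lt0 st0 p0 hk next]]]]; [by left|right].
  exists k0, s0; split=> //; first exact: ltnW.
  move=> k' s' lt' st' p'; have := next _ _ lt' st' p'.
  rewrite leq_eqVlt => /orP[/eqP ek|//]; move: st'; rewrite -ek st => -[es].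
  by case: nps; rewrite es.
case: IH => [->|[k0 [s0 [lt0 st0 p0 hk next]]]]; [by left|right].
exists k0, s0; split=> //; first exact: ltnW.
move=> k' s' lt' st' p'; have := next _ _ lt' st' p'.
by rewrite leq_eqVlt => /orP[/eqP ek|//]; move: st'; rewrite -ek st.
Qed.

Lemma next_step q k0 s0 k s : (k0 < k)%N -> steps E k0 = Some s0 -> proc s0 = q ->
  steps E k = Some s -> proc s = q -> exists k1 s1,
  [/\ (k0 < k1 <= k)%N, steps E k1 = Some s1, proc s1 = q
    & history_before E q k1 = rcons (history_before E q k0) (time s0, ev s0)].
Proof.
elim: k {-2}k (leqnn k) s => [|m IH] k lem s lt0 st0 p0 st p; first by lia.
have [hk|[k' [s' [lt' st' p' hk next]]]] := history_last q k.
  by have := size_history_lt lt0 st0 p0; rewrite hk.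
have ge0 : (k0 <= k')%N.
  by rewrite leqNgt; apply/negP => ltk; have := next _ _ ltk st0 p0; lia.
move: ge0; rewrite leq_eqVlt => /orP[/eqP ek|ltk].
  exists k, s; split=> //; first by rewrite lt0 leqnn.
  by move: st'; rewrite hk -ek st0 => -[->].
have [|k1 [s1 [/andP[lt1 le1] st1 p1 h1]]] := IH k' _ s' ltk st0 p0 st' p'; first by lia.
by exists k1, s1; split=> //; rewrite lt1 /=; lia.
Qed.

Lemma first_step q k s : steps E k = Some s -> proc s = q -> exists k1 s1,
  [/\ (k1 <= k)%N, steps E k1 = Some s1, proc s1 = q & history_before E q k1 = [::]].
Proof.
elim: k {-2}k (leqnn k) s => [|m IH] k lem s st p.
  by exists k, s; split=> //; have -> : k = 0%N by lia.
have [hk|[k' [s' [lt' st' p' hk next]]]] := history_last q k; first by exists k, s.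
have [|k1 [s1 [le1 st1 p1 h1]]] := IH k' _ s' st' p'; first by lia.
by exists k1, s1; split=> //; lia.
Qed.

Variable sigma : 'I_n -> vproc.

(** The length of the sender's history just before the sending step is the index of that step among
    the sender's own steps. [sigma] selects the virtual process credited with the message. For
    events other than receptions the source carries no meaning. *)
Definition entry_of (k : nat) : option entry :=
  if steps E k is Some s then
    Some ((time s, ev s),
      if steps E (origin E k).1 is Some s' then
        (sigma (proc s'), size (history_before E (proc s') (origin E k).1),
          (origin E k).2)
      else (sigma (proc s), 0, 0)%N)
  else None.

Definition local_steps (q : 'I_n) (K : nat) : seq (option entry) :=
  [seq entry_of k | k <- iota 0 K &
     if steps E k is Some s then proc s == q else false].

Lemma local_stepsS q K : local_steps q K.+1 =
  if steps E K is Some s then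
    if proc s == q then rcons (local_steps q K) (entry_of K) else local_steps q K
  else local_steps q K.
Proof.
rewrite /local_steps -addn1 iotaD filter_cat map_cat add0n /=.
case: (steps E K) => [s|] /=; last by rewrite cats0.
by case: ifP => _ /=; rewrite ?cats1 ?cats0.
Qed.

Lemma hist_local_steps q K : hist_of (local_steps q K) = history_before E q K.
Proof.
elim: K => // K IH; rewrite local_stepsS history_beforeS /entry_of.
case st: (steps E K) => [s|] //; case: ifP => // _.
by rewrite hist_of_rcons IH.
Qed.

Lemma size_local_steps q K : size (local_steps q K) = size (history_before E q K).
Proof.
elim: K => // K IH; rewrite local_stepsS history_beforeS.
by case: (steps E K) => [s|] //; case: ifP => // _; rewrite !size_rcons IH.
Qed.

Lemma local_steps_cat q k d :
  exists t, local_steps q (k + d) = local_steps q k ++ t.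
Proof.
elim: d => [|d [t IH]]; first by exists [::]; rewrite addn0 cats0.
rewrite addnS local_stepsS; case: (steps E _) => [s|]; last by exists t.
by case: ifP => _; [rewrite IH -cats1 -catA; eexists | exists t].
Qed.

Lemma nth_local_steps q k K s : (k < K)%N -> steps E k = Some s -> proc s = q ->
  nth None (local_steps q K) (size (history_before E q k)) = entry_of k /\
  hist_of (take (size (history_before E q k)) (local_steps q K)) =
    history_before E q k.
Proof.
move=> ltk st ps; have [t] := local_steps_cat q k.+1 (K - k.+1).
rewrite subnKC // local_stepsS st ps eqxx => ->; rewrite cat_rcons -size_local_steps.
by rewrite nth_cat ltnn subnn /= take_size_cat // hist_local_steps.
Qed.

Lemma local_stepsP q K i e : nth None (local_steps q K) i = Some e ->
  exists k s, [/\ (k < K)%N, steps E k = Some s, proc s = q,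
    i = size (history_before E q k) & entry_of k = Some e].
Proof.
elim: K => [|K IH]; first by rewrite nth_nil.
have up : nth None (local_steps q K) i = Some e -> exists k s,
    [/\ (k < K.+1)%N, steps E k = Some s, proc s = q,
    i = size (history_before E q k) & entry_of k = Some e].
  by case/IH=> k [s [ltk ? ? ? ?]]; exists k, s; split=> //; exact: ltnW.
rewrite local_stepsS; case st: (steps E K) => [s|] //; case: eqP => // ps.
rewrite nth_rcons; case: ifP => // _; case: eqP => // ei eK.
by exists K, s; split=> //; rewrite ei size_local_steps.
Qed.

Hypothesis E_timed : well_timed E.

(** An event later than a pending alarm would leave room for the step that [follows] demands by the
    time of the alarm, although the history shows no step in between. *)
Lemma follows_legal (H : R -> Prop) q k s :
  (forall tau tau', tau <= tau' -> H tau' -> H tau) ->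
  follows H E q -> steps E k = Some s -> proc s = q -> H (time s) ->
  legal_next q (init E q) (history_before E q k) (time s, ev s).
Proof.
move=> H_down [_ fl_ev fl_al] st ps Hs; have [_ mono _] := E_timed.
have [_ evs] := fl_ev _ _ st ps Hs; split=> //=.
- move=> h' y hy; have : List.In y (history_before E q k).
    by rewrite hy -cats1; elim: h' {hy} => [|z h' IHh] /=; [left | right].
  by case/In_history=> k' [s' [ltk st' _ ->]]; exact: mono (ltnW ltk) st' st.
- move=> a nnil al; have [//|[k0 [s0 [lt0 st0 p0 hk next]]]] := history_last q k.
  rewrite hk in al; rewrite leNgt; apply/negP => lta.
  have [k' [s' [lt' st' p' le']]] := fl_al _ _ _ st0 p0 al (H_down _ _ (ltW lta) Hs).
  have := mono _ _ _ _ (next _ _ lt' st' p') st st'.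
  by move=> le2; have := lt_le_trans lta (le_trans le2 le'); rewrite ltxx.
Qed.

(** Since times are ordered, a bounded initial segment of time is an initial segment of step
    indices. The cut is found by descending from an index after which all steps are later than
    [M]. *)
Lemma cut_exists (p : pred R) (M : R) :
  (forall tau tau', tau <= tau' -> p tau' -> p tau) ->
  (forall tau, M < tau -> ~~ p tau) ->
  exists K, forall k s, steps E k = Some s -> (k < K)%N = p (time s).
Proof.
move=> p_down p_M; have [_ mono div] := E_timed.
have [K0] := div M; have : (forall k s, (K0 <= k)%N -> steps E k = Some s -> M < time s) ->
    forall k s, (K0 <= k)%N -> steps E k = Some s -> ~~ p (time s).
  by move=> h k s lek st; exact/p_M/(h k).
move=> /[apply]; elim: K0 => [|K0 IH] late.
  by exists 0%N => k s st; apply/esym/negbTE; exact: late st.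
case st0: (steps E K0) => [s0|].
  have [p0|np0] := boolP (p (time s0)).
    exists K0.+1 => k s st; case: ltnP => lek.
      by apply/esym/(p_down _ _ _ p0); exact: mono st st0.
    by apply/esym/negbTE; exact: late st.
  apply: IH => k s; rewrite leq_eqVlt => /orP[/eqP<-|]; last exact: late.
  by rewrite st0 => -[<-].
by apply: IH => k s; rewrite leq_eqVlt => /orP[/eqP<-|]; [rewrite st0|exact: late].
Qed.

End Histories.

(** * Structure of two-step executions *)

Section TwoStep.
Variables (R : realType) (n : nat) (V : Type) (P : protocol R n V).
Variables (f : nat) (Delta : R) (T : {set 'I_n}) (E : execution R n V (data P)).
Hypothesis Delta_gt0 : 0 < Delta.
Hypothesis E_two_step : two_step_execution f Delta T E.

Lemma two_step_well_timed : well_timed E.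
Proof. by have [[[_ ? _ _ _] _] _ _ _ _] := E_two_step. Qed.

(** The times at which [q] is bound to the protocol: before [Delta] for silent processes, always for
    the others. This treats both kinds uniformly. *)
Definition obeyed (q : 'I_n) (tau : R) : Prop := q \in T -> tau < Delta.

Lemma obeyed_down q tau tau' : tau <= tau' -> obeyed q tau' -> obeyed q tau.
Proof. by move=> le_t ob qT; exact: le_lt_trans le_t (ob qT). Qed.

Lemma obeyed_step k s : steps E k = Some s -> obeyed (proc s) (time s).
Proof. by have [_ _ _ stop _] := E_two_step; move=> st; exact: stop st. Qed.

Lemma two_step_follows q : follows (obeyed q) E q.
Proof.
have [[[_ _ _ fl _] bE] _ flT _ _] := E_two_step.
case: (boolP (q \in T)) => qT.
  have -> : obeyed q = (fun tau => is_true (tau < Delta)); last exact: flT.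
  by apply/funext => tau; apply/propext; split=> [/(_ qT)|h _].
have -> : obeyed q = (fun=> True); last by apply: fl; rewrite bE.
by apply/funext => tau; apply/propext; split=> // _; rewrite /obeyed (negPf qT).
Qed.

Lemma two_step_legal q k s : steps E k = Some s -> proc s = q ->
  legal_next q (init E q) (history_before E q k) (time s, ev s).
Proof.
move=> st ps; apply: (follows_legal two_step_well_timed _ (two_step_follows q)) => //.
  exact: obeyed_down.
by rewrite -ps; exact: obeyed_step st.
Qed.

Lemma two_step_sends q k s : steps E k = Some s -> proc s = q ->
  sends s = out q (init E q) (rcons (history_before E q k) (time s, ev s)).
Proof.
move=> st ps; have [_ fl _] := two_step_follows q.
by have [|-> _] := fl _ _ st ps; rewrite -?ps //; exact: obeyed_step st.
Qed.

(** The truncated quotient of the sending time by [Delta] is the number of full rounds elapsed: 0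
    gives delivery at [Delta], anything larger gives delivery at [2 * Delta] or later. In particular
    a delivery by [2 * Delta] stems from one of the first two rounds. *)
Lemma two_step_receive k s q m : steps E k = Some s -> ev s = Receive q m ->
  exists s', [/\ sent E (origin E k) s' (proc s) m, proc s' = q,
    ((origin E k).1 < k)%N & time s' < Delta /\ time s = Delta \/
    [/\ Delta <= time s', 2 * Delta <= time s, time s' < time s
      & time s <= 2 * Delta -> time s' < 2 * Delta]].
Proof.
move=> st evs; have [[[_ [ge0 _ _] [[auth _] _] _ _] _] lock _ _ _] := E_two_step.
have [lt [s' [snt ps']]] := auth _ _ _ _ st evs; exists s'; split=> //.
have t_ge0 : 0 <= time s' / Delta by rewrite divr_ge0 ?(ltW Delta_gt0) ?(ge0 _ _ snt.1).
have := Num.Theory.trunc_itv t_ge0; set r := Num.trunc _.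
rewrite ler_pdivlMr // ltr_pdivrMr // => itv.
have [/(_ k s) recv _] := lock _ _ _ _ _ snt itv.
have {recv}tE : time s = r.+1%:R * Delta by apply: recv; split=> //; rewrite evs.
move/andP: itv => [lo hi]; rewrite tE; case: r {t_ge0} lo hi tE => [|[|r]] lo hi tE.
- by left; rewrite mul1r in hi *.
- by right; rewrite mul1r in lo; rewrite lexx.
have D2 : r.+3%:R * Delta = r%:R * Delta + 3%:R * Delta.
  by rewrite -mulrDl -natrD addn3.
have : 0 <= r%:R * Delta by rewrite mulr_ge0 // ltW.
rewrite D2 => rD; right; split; [|lra|lra|lra].
apply: le_trans lo; rewrite ler_peMl ?(ltW Delta_gt0) //.
by rewrite ler1n.
Qed.

Lemma two_step_delivered id s q m : sent E id s q m -> time s < Delta ->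
  q \notin T -> exists k s', received E id k s' /\ time s' = Delta.
Proof.
move=> snt lt_t qT; have [[[_ [ge0 _ _] _ _ _] _] lock _ _ _] := E_two_step.
have itv : 0%:R * Delta <= time s < 1%:R * Delta.
  by rewrite mul0r mul1r lt_t (ge0 _ _ snt.1).
have [tE /(_ qT) [k [s' rc]]] := lock _ _ _ _ _ snt itv.
by exists k, s'; split=> //; rewrite (tE _ _ rc) mul1r.
Qed.

Lemma receive_late k s : steps E k = Some s -> is_receive (ev s) -> Delta <= time s.
Proof.
move=> st; case evs: (ev s) => [|| q m] // _.
have [s' [_ _ _ [[_ ->]|[_ h _ _]]]] := two_step_receive st evs => //.
by apply: le_trans h; rewrite ler_peMl ?(ltW Delta_gt0) // ler1n.
Qed.

(** Nothing is received before [Delta], so no foreign signature can be passed on in the first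
    round. *)
Lemma early_signature k s pos q m r c : time s < Delta ->
  sent E (k, pos) s q m -> has_signature r c m -> r = proc s.
Proof.
move=> lt_t [/= st snt] sig; apply: contrapT => nr.
have := onth_In snt; rewrite (two_step_sends st erefl) => mout.
have [tau [q' [m' [rin _]]]] := out_signatures mout sig nr.
have [_ mono _] := two_step_well_timed.
case: (In_rcons rin) => [/In_history[k' [s' [ltk st' _ [_ evs]]]]|[_ evs]].
  have := receive_late st'; rewrite -evs => /(_ isT) late.
  by have := le_lt_trans (le_trans late (mono _ _ _ _ (ltnW ltk) st' st)) lt_t; rewrite ltxx.
by have := receive_late st; rewrite -evs leNgt lt_t => /(_ isT).
Qed.

Lemma start_at0 q : exists k s, [/\ steps E k = Some s, proc s = q, ev s = Start,
  time s = 0 & history_before E q k = [::]].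
Proof.
have [[k [s [st ps]]] _ _] := two_step_follows q.
have [k1 [s1 [_ st1 p1 h1]]] := first_step st ps.
exists k1, s1; have [+ _ _] := two_step_legal st1 p1; rewrite h1 /=.
by case: (ev s1) => [[]|[]|].
Qed.

End TwoStep.

(* Nothing is received before time Delta, so that the first round of a process
   depends only on its input. *)
Lemma first_round (R : realType) (n : nat) (V : Type) (P : protocol R n V)
    (f : nat) (Delta : R) (T T' : {set 'I_n}) (E E' : execution R n V (data P))
    (q : 'I_n) k s :
  0 < Delta ->
  two_step_execution f Delta T E -> two_step_execution f Delta T' E' ->
  init E q = init E' q -> steps E k = Some s -> proc s = q -> time s < Delta ->
  exists k' s', [/\ steps E' k' = Some s', proc s' = q, time s' = time s,
    ev s' = ev s & history_before E' q k' = history_before E q k].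
Proof.
move=> D0 ts ts' iE; have [m] := ubnP k; elim: m k s => // m IH k s.
rewrite ltnS => lek st ps lt_t; have [evs _ _] := two_step_legal ts st ps.
have not_receive := @receive_late _ _ _ _ _ _ _ _ D0 ts _ _ st.
have [start|[k0 [s0 [lt0 st0 p0 hk _]]]] := history_last E q k.
  move: evs not_receive; rewrite start /=.
  have [k' [s' [st' p' e' t' h']]] := start_at0 ts' q.
  case: (ev s) => [[_ ->] _|[/(_ erefl)] //|q' m' _ /(_ isT)]; first by exists k', s'.
  by rewrite leNgt lt_t.
move: evs not_receive; rewrite hk /=.
case: (ev s) => [[]|[_ al] _|q' m' _ /(_ isT)]; first by case: history_before.
  have [_ mono _] := two_step_well_timed ts.
  have [||k0' [s0' [st0' p0' t0' e0' h0']]] := IH k0 s0 _ st0 p0.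
  - exact: leq_trans lt0 lek.
  - exact: le_lt_trans (mono _ _ _ _ (ltnW lt0) st0 st) lt_t.
  (* The equal histories set the same alarm, which forces a step of [E'] by that time. The next step
     lies before [Delta], so it is no reception and must be the timer. *)
  have [_ _ next] := two_step_follows ts' q.
  have [||k' [s' [lt' st' p' le']]] := next _ _ (time s) st0' p0'.
  - by rewrite t0' e0' h0' -iE.
  - by move=> _.
  have [k1 [s1 [/andP[lt1 le1] st1 p1 h1]]] := next_step lt' st0' p0' st' p'.
  have [_ mono' _] := two_step_well_timed ts'.
  have le_t1 : time s1 <= time s by exact: le_trans (mono' _ _ _ _ le1 st1 st') le'.
  have [evs1 _ _] := two_step_legal ts' st1 p1.
  have := @receive_late _ _ _ _ _ _ _ _ D0 ts' _ _ st1.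
  move: evs1; rewrite h1 t0' e0' h0' /=.
  case ev1: (ev s1) => [||q1 m1].
  - by case; case: history_before.
  - rewrite -iE al => -[_ [t1]] _; exists k1, s1; split=> //.
    by rewrite h1 t0' e0' h0'.
  - move=> _ /(_ isT) /le_trans => /(_ _ le_t1).
    by rewrite leNgt lt_t.
by rewrite leNgt lt_t.
Qed.

(** * Replaying two-step executions *)

Section Scenario.
Variables (R : realType) (n : nat) (V : Type) (P : protocol R n V).
Local Notation vproc := (vproc n).
Variables (f : nat) (Delta : R) (T : bool -> {set 'I_n}).
Variable alpha : bool -> execution R n V (data P).
Hypothesis Delta_gt0 : 0 < Delta.
Hypothesis alpha_two_step : forall b, two_step_execution f Delta (T b) (alpha b).

(* How long a virtual process replays its two-step execution: not at all, for
   one round, for two rounds, or up to and including time [2 * Delta]. *)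
Definition replays (l : nat) (tau : R) : bool :=
  match l with
  | 0 => false
  | 1 => tau < Delta
  | 2 => tau < 2 * Delta
  | _ => tau <= 2 * Delta
  end.

Lemma replays_down l tau tau' : tau <= tau' -> replays l tau' -> replays l tau.
Proof.
case: l => [|[|[|l]]] //= le_t; [exact: le_lt_trans|exact: le_lt_trans|].
exact: le_trans.
Qed.

Lemma replays_le l tau : replays l tau -> tau <= 2 * Delta.
Proof. by case: l => [|[|[|l]]] //= h; have := Delta_gt0; lra. Qed.

Lemma replays1 l tau : (1 <= l)%N -> tau < Delta -> replays l tau.
Proof. by case: l => [|[|[|l]]] //= _ h; have := Delta_gt0; lra. Qed.

Lemma replays2 l tau : (2 <= l)%N -> tau < 2 * Delta -> replays l tau.
Proof. by case: l => [|[|[|l]]] //= _ /ltW. Qed.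

Lemma cut_index_exists b l : exists K, forall k s,
  steps (alpha b) k = Some s -> (k < K)%N = replays l (time s).
Proof.
apply: (cut_exists (M := 2 * Delta) (two_step_well_timed (alpha_two_step b))).
- by move=> tau tau'; exact: replays_down.
- by move=> tau; apply: contraTN => /replays_le; rewrite leNgt.
Qed.

Definition cut_index b l : nat := projT1 (cid (cut_index_exists b l)).

Lemma cut_indexP b l k s : steps (alpha b) k = Some s ->
  (k < cut_index b l)%N = replays l (time s).
Proof. exact: (projT2 (cid (cut_index_exists b l))). Qed.

Variables (F : {set 'I_n}) (lvl : vproc -> nat) (view : vproc -> bool).
Variable flag : vproc -> 'I_n -> bool.

Definition replay_input (j : vproc) : V := init (alpha (view j)) j.1.

(* The message that [j] receives from [r] is attributed to the virtual process
   [(r, flag j r)]. *)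
Definition replay : state P := fun j =>
  local_steps (alpha (view j)) (fun r => (r, flag j r)) j.1
    (cut_index (view j) (lvl j)).

Lemma replay_nth j k s : steps (alpha (view j)) k = Some s -> proc s = j.1 ->
  replays (lvl j) (time s) ->
  let h := history_before (alpha (view j)) j.1 k in
  nth None (replay j) (size h) =
    entry_of (alpha (view j)) (fun r => (r, flag j r)) k /\
  hist_of (take (size h) (replay j)) = h.
Proof.
move=> st ps rep; have ltk : (k < cut_index (view j) (lvl j))%N.
  by rewrite (cut_indexP _ st).
exact: nth_local_steps ltk st ps.
Qed.

Lemma replayP j i e : nth None (replay j) i = Some e -> exists k s,
  [/\ steps (alpha (view j)) k = Some s, proc s = j.1, replays (lvl j) (time s),
      i = size (history_before (alpha (view j)) j.1 k)
    & entry_of (alpha (view j)) (fun r => (r, flag j r)) k = Some e].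
Proof.
case/local_stepsP=> k [s [ltk st ps ei ee]]; exists k, s; split=> //.
by rewrite -(cut_indexP _ st).
Qed.

Lemma entry_ofE (E : execution R n V (data P)) sigma k s : steps E k = Some s ->
  exists src, entry_of E sigma k = Some ((time s, ev s), src).
Proof. by rewrite /entry_of => ->; eexists. Qed.

Lemma entry_of_sent (E : execution R n V (data P)) sigma k s s' q m :
  steps E k = Some s -> sent E (origin E k) s' q m ->
  entry_of E sigma k = Some ((time s, ev s), (sigma (proc s'),
    size (history_before E (proc s') (origin E k).1), (origin E k).2)).
Proof. by rewrite /entry_of => -> [-> _]. Qed.

Lemma replay_sends j k s : steps (alpha (view j)) k = Some s -> proc s = j.1 ->
  replays (lvl j) (time s) ->
  sends_at replay_input j (replay j) (size (history_before (alpha (view j)) j.1 k))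
    = sends s.
Proof.
move=> st ps rep; have [nthk histk] := replay_nth st ps rep.
have [src es] := entry_ofE (fun r => (r, flag j r)) st.
by rewrite /sends_at nthk es histk (two_step_sends (alpha_two_step _) st ps).
Qed.

(** From level 2 on, first-round messages are received. The sender credited with them may replay the
    other execution, provided that its input is the same: by [first_round] it then sends the same
    messages. *)
Hypothesis flag_input : forall (j : vproc) r, j.2 -> (2 <= lvl j)%N ->
  init (alpha (view (r, flag j r))) r = init (alpha (view j)) r.
Hypothesis flag_level : forall (j : vproc) r, j.2 -> (2 <= lvl j)%N ->
  (1 <= lvl (r, flag j r))%N.
(** At level 3 also the second-round messages arriving at [2 * Delta] are seen. Their senders must
    replay two rounds of the very same execution, except for those that are silent in it. *)
Hypothesis flag_late : forall (j : vproc) r, j.2 -> (3 <= lvl j)%N ->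
  r \notin T (view j) ->
  view (r, flag j r) = view j /\ (2 <= lvl (r, flag j r))%N.
Hypothesis phantom_byz : forall j : vproc, ~~ j.2 -> (1 <= lvl j)%N -> j.1 \in F.
(** A phantom sees first-round messages at most, and its real counterpart, which is not silent in
    its own view, receives first-round messages too. This is what justifies the signatures a phantom
    learns. *)
Hypothesis phantom_level : forall j : vproc, ~~ j.2 -> (2 <= lvl j)%N ->
  [/\ (lvl j <= 2)%N, (2 <= lvl (j.1, true))%N & j.1 \notin T (view (j.1, true))].
Hypothesis correct_input : forall r b, r \notin F ->
  init (alpha b) r = init (alpha false) r.

Lemma replay_legal j : legal_seq replay_input j (replay j).
Proof.
move=> i e /replayP[k [s [st ps rep -> ee]]].
have [_ ->] := replay_nth st ps rep.
have [src] := entry_ofE (fun r => (r, flag j r)) st; rewrite ee => -[->] /=.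
by have := two_step_legal (alpha_two_step _) st ps.
Qed.

Lemma replay_le j : times_le (2 * Delta) (replay j).
Proof.
move=> i e /replayP[k [s [st ps rep _ ee]]].
have [src] := entry_ofE (fun r => (r, flag j r)) st; rewrite ee => -[->] /=.
exact: replays_le rep.
Qed.

(** For a first-round message, [first_round] finds the sending step in the execution replayed by the
    credited sender. A second-round message forces level 3, where the sender shares the receiver's
    view. *)
Lemma replay_src (j : vproc) i tau q m j' i' pos : j.2 ->
  nth None (replay j) i = Some ((tau, Receive q m), (j', i', pos)) ->
  j'.1 = q /\ exists e', [/\ nth None (replay j') i' = Some e', e'.1.1 < tau
    & onth (sends_at replay_input j' (replay j') i') pos = Some (j.1, m)].
Proof.
move=> jT /replayP[k [s [st ps rep _ ee]]].
have [src] := entry_ofE (fun r => (r, flag j r)) st; rewrite ee => -[et evs _].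
have [s' [snt pq lt_k tms]] := two_step_receive Delta_gt0 (alpha_two_step _) st (esym evs).
move: ee; rewrite (entry_of_sent _ st snt) => -[_ _ <- <- <-] /=; split=> //.
rewrite et; case: snt => st' snt; rewrite ps in snt.
have [early tau2] : time s' < time s /\ Delta <= time s.
  by case: tms => [[h1 ->]|[_ h1 h2 _]]; have := Delta_gt0; split=> //; lra.
have lvl2 : (2 <= lvl j)%N.
  move: rep; case: (lvl j) => [|[|l]] //=; rewrite ltNge.
  by case/negP.
set a : vproc := (proc s', flag j (proc s')).
have finish b k2 s2 : view a = b -> steps (alpha b) k2 = Some s2 -> proc s2 = a.1 ->
    time s2 = time s' -> sends s2 = sends s' -> replays (lvl a) (time s2) ->
    history_before (alpha b) a.1 k2 = history_before (alpha (view j)) a.1 (origin (alpha (view j)) k).1 ->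
    exists e', [/\ nth None (replay a) (size (history_before (alpha (view j)) (proc s') (origin (alpha (view j)) k).1)) = Some e',
      e'.1.1 < time s & onth (sends_at replay_input a (replay a)
        (size (history_before (alpha (view j)) (proc s') (origin (alpha (view j)) k).1)))
        (origin (alpha (view j)) k).2 = Some (j.1, m)].
  move=> <- st2 p2 t2 s2E rep2 h2; rewrite -h2.
  have [nth2 _] := replay_nth st2 p2 rep2.
  have [src2 e2] := entry_ofE (fun r => (r, flag a r)) st2.
  exists (time s2, ev s2, src2); rewrite nth2 e2 /= t2 early; split=> //.
  by rewrite (replay_sends st2 p2 rep2) s2E.
case: tms => [[lt1 _]|[ge1 ge2 _ lt2]].
  have eqI := @flag_input j (proc s') jT lvl2.
  have [k2 [s2 [st2 p2 t2 e2 h2]]] := first_round Delta_gt0 (alpha_two_step _)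
    (alpha_two_step (view a)) (esym eqI) st' erefl lt1.
  apply: (finish _ k2 s2) => //.
    rewrite (two_step_sends (alpha_two_step _) st2 p2).
    by rewrite (two_step_sends (alpha_two_step _) st' erefl) h2 t2 e2 eqI.
  by rewrite t2; apply: replays1 => //; exact: flag_level.
have lvl3 : (3 <= lvl j)%N.
  move: rep ge2; case: (lvl j) lvl2 => [|[|[|l]]] //= _; rewrite ltNge.
  by move/negP.
have qT : proc s' \notin T (view j).
  apply/negP => /(obeyed_step (alpha_two_step _) st').
  by rewrite ltNge ge1.
have [vE lv2] := flag_late jT lvl3 qT.
have {}lv2 : (2 <= lvl a)%N by [].
apply: (finish _ _ s' vE st') => //.
by apply: (replays2 lv2); apply: lt2; exact: replays_le rep.
Qed.

(** A source determines the sending step, as distinct steps of a process have histories of distinct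
    lengths; the channels of the original execution deliver each message once. *)
Lemma replay_uniq (j : vproc) : j.2 -> uniq (sources_of (replay j)).
Proof.
move=> jT; rewrite /replay; elim: (cut_index _ _) => // K IH.
rewrite local_stepsS; case st: (steps _ K) => [s|] //; case: eqP => // ps.
rewrite -cats1 sources_of_cat cat_uniq IH /=.
have [src es] := entry_ofE (fun r => (r, flag j r)) st.
rewrite es; case evs: (ev s) => [|| q m] //; rewrite /= orbF andbT.
apply/negP => /mem_sources_of[i [e [/local_stepsP[k [s2 [ltk st2 p2 _ ee]]] rc esrc]]].
have [src2 es2] := entry_ofE (fun r => (r, flag j r)) st2.
move: ee rc esrc; rewrite es2 => -[<-] /=.
case evs2: (ev s2) => [|| q2 m2] // _ eqsrc.
have [s' [snt _ _ _]] := two_step_receive Delta_gt0 (alpha_two_step _) st evs.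
have [s2' [snt2 _ _ _]] := two_step_receive Delta_gt0 (alpha_two_step _) st2 evs2.
move: es es2; rewrite (entry_of_sent _ st snt) (entry_of_sent _ st2 snt2).
move=> [e1] [e2]; rewrite -e2 -e1 in eqsrc.
case: eqsrc => eqp _ eqsz eqpos; rewrite -eqp in eqsz.
have eqk := size_history_inj snt2.1 eqp snt.1 erefl.
have [[[_ _ [[_ once] _] _ _] _] _ _ _ _] := alpha_two_step (view j).
have : k = K.
  apply: (once (origin (alpha (view j)) K) k K s2 s); split; rewrite ?evs ?evs2 //.
  rewrite [LHS]surjective_pairing [RHS]surjective_pairing eqpos; congr (_, _).
  by apply: eqk; rewrite -?eqp.
by move=> ekK; move: ltk; rewrite ekK ltnn.
Qed.

(** A phantom only receives first-round messages, so a correct signature in one belongs to its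
    sender. This correct sender has the same input in both executions, hence sends the same message
    to the real counterpart, also delivered at time [Delta]. *)
Lemma replay_phantom (j : vproc) i tau q m src r c : ~~ j.2 ->
  nth None (replay j) i = Some ((tau, Receive q m), src) ->
  has_signature r c m -> r \notin F ->
  exists (j' : vproc) i' tau' q' m' src', [/\ j'.2, j'.1 \in F,
    nth None (replay j') i' = Some ((tau', Receive q' m'), src'), tau' <= tau
    & has_signature r c m'].
Proof.
move=> jF /replayP[k [s [st ps rep _ ee]]] sig rF.
have [src'] := entry_ofE (fun r => (r, flag j r)) st; rewrite ee => -[et evs _].
have [s' [snt pq lt_k tms]] := two_step_receive Delta_gt0 (alpha_two_step _) st (esym evs).
have lateD : Delta <= time s.
  by apply: (receive_late Delta_gt0 (alpha_two_step _) st); rewrite -evs.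
have lvl2 : (2 <= lvl j)%N.
  by move: rep; case: (lvl j) => [|[|l]] //=; rewrite ltNge; case/negP.
have [lvl_le lvl_real jT] := phantom_level jF lvl2.
have {rep}lt2 : time s < 2 * Delta.
  by move: lvl_le lvl2 rep; case: (lvl j) => [|[|[|l]]].
have {tms}[lt1 tsD] : time s' < Delta /\ time s = Delta.
  by case: tms => // -[_ ge2]; move: lt2; rewrite ltNge ge2.
have rE : r = proc s'.
  move: snt; rewrite [origin _ _]surjective_pairing => snt.
  by have := early_signature Delta_gt0 (alpha_two_step _) lt1 snt sig.
have eqI : init (alpha (view j)) (proc s') = init (alpha (view (j.1, true))) (proc s').
  by rewrite -rE !(correct_input _ rF).
have [k2 [s2 [st2 p2 t2 e2 h2]]] := first_round Delta_gt0 (alpha_two_step _)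
    (alpha_two_step _) eqI snt.1 erefl lt1.
have snt2 : sent (alpha (view (j.1, true))) (k2, (origin (alpha (view j)) k).2) s2 j.1 m.
  split=> //; rewrite (two_step_sends (alpha_two_step _) st2 p2) h2 t2 e2 -eqI.
  by rewrite -(two_step_sends (alpha_two_step _) snt.1 erefl) -ps snt.2.
have lt12 : time s2 < Delta by rewrite t2.
have [k3 [s3 [[st3 rc3 o3] t3]]] := two_step_delivered (alpha_two_step _) snt2 lt12 jT.
case ev3: (ev s3) rc3 => [|| q3 m3] // _.
have [s4 [snt4 _ _ _]] := two_step_receive Delta_gt0 (alpha_two_step _) st3 ev3.
have [eq_p eq_m] : (proc s3, m3) = (j.1, m).
  move: snt4; rewrite o3 => -[st4 on4]; case: snt2 => st2' on2.
  by move: st4 on4; rewrite st2' => -[<-]; rewrite on2 => -[-> ->].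
have rep3 : replays (lvl (j.1, true)) (time s3).
  by apply: replays2 => //; rewrite t3; have := Delta_gt0; lra.
have [nth3 _] := replay_nth (j := (j.1, true)) st3 eq_p rep3.
have [src3 es3] := entry_ofE (fun r => (r, flag (j.1, true) r)) st3.
exists (j.1, true), (size (history_before (alpha (view (j.1, true))) j.1 k3)), (time s3), q3, m3, src3; split=> //.
- by apply: phantom_byz jF _; exact: ltnW.
- by rewrite nth3 es3 ev3.
- by rewrite et tsD t3.
- by rewrite eq_m.
Qed.

Lemma replay_start j : (1 <= lvl j)%N -> hist_of (replay j) <> [::].
Proof.
move=> lvl1; have [k [s [st ps es ts _]]] := start_at0 (alpha_two_step (view j)) j.1.
rewrite /replay hist_local_steps => h.
have ltk : (k < cut_index (view j) (lvl j))%N.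
  by rewrite (cut_indexP _ st) ts; exact: replays1.
by have := size_history_lt ltk st ps; rewrite h.
Qed.

Variables (act : pred vproc) (dlv : nat -> rel vproc).

Lemma replay_execution :
  (#|F| <= f)%N ->
  (forall j, act j -> j.2 && (1 <= lvl j)%N) ->
  (forall q, q \notin F -> act (q, true)) ->
  (exists N, forall r (j : vproc) q, (N <= r)%N -> j.2 -> j.1 \notin F ->
    q \notin F -> dlv r j (q, true)) ->
  exists E : execution R n V (data P),
  [/\ admissible f Delta E, byz E = F, init E = (fun q => replay_input (q, true))
    & forall q v, q \notin F -> (exists k s, decides E q k s v) <->
        (exists r, decides_in replay_input
           (stage replay_input Delta (2 * Delta) replay act dlv r) q v)].
Proof.
move=> F_le act_lvl act_correct fair.
apply: rounds_execution => //.
- exact: replay_legal.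
- exact: replay_le.
- exact: replay_src.
- exact: replay_uniq.
- exact: replay_phantom.
- move=> j i e jF /replayP[k [s [_ _ rep _ _]]]; apply: phantom_byz => //.
  by case: (lvl j) rep.
- by move=> j /act_lvl/andP[].
- by move=> j /act_lvl/andP[_]; exact: replay_start.
Qed.

Lemma replay_decides q k s v : decides (alpha (view (q, true))) q k s v ->
  replays (lvl (q, true)) (time s) -> decides_in replay_input replay q v.
Proof.
move=> [st ps dec] rep; have [nthk histk] := replay_nth (j := (q, true)) st ps rep.
have [src es] := entry_ofE (fun r => (r, flag (q, true) r)) st.
exists (size (history_before (alpha (view (q, true))) q k)), (time s, ev s, src).
by rewrite nthk es histk.
Qed.

End Scenario.

(** * The lower bound *)

Section LowerBound.
Variables (R : realType) (n : nat) (V : Type) (P : protocol R n V).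
Local Notation vproc := (vproc n).
Variables (f t : nat) (Delta : R).
Hypothesis Delta_gt0 : 0 < Delta.
Hypothesis consensus : weak_consensus P f Delta.

Definition fast_decision (T : {set 'I_n}) (E : execution R n V (data P)) (v : V)
    : Prop :=
  two_step_execution f Delta T E /\
  forall p, p \notin T -> exists k s, decides E p k s v /\ time s <= 2 * Delta.

Lemma fast_decision_exists (T : {set 'I_n}) (E : execution R n V (data P)) q :
  two_step_execution f Delta T E -> q \notin T -> exists v, fast_decision T E v.
Proof.
move=> ts qT; have [[adm bE] _ _ _ fast] := ts.
have [_ _ cons _] := consensus adm.
have [k [s [v [dec _]]]] := fast q qT; exists v; split=> // p pT.
have [k' [s' [v' [dec' le_t]]]] := fast p pT; exists k', s'; split=> //.
by have <- : v' = v by apply: cons dec' dec; rewrite bE.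
Qed.

Lemma decides_in_replay (alpha : bool -> execution R n V (data P)) T
    (ts : forall b, two_step_execution f Delta (T b) (alpha b)) lvl view flag q v :
  fast_decision (T (view (q, true))) (alpha (view (q, true))) v ->
  q \notin T (view (q, true)) -> (3 <= lvl (q, true))%N ->
  decides_in (replay_input alpha view) (replay Delta_gt0 ts lvl view flag) q v.
Proof.
move=> [_ fast] /fast[k [s [dec le_t]]] lvl3.
apply: replay_decides dec _.
by case: (lvl _) lvl3 => [|[|[|l]]].
Qed.

(* If the processes of [T] are merely slow, then all processes are correct, and
   weak validity applies. *)
Lemma fast_validity (T : {set 'I_n}) (E : execution R n V (data P)) v w q :
  fast_decision T E w -> q \notin T -> (forall p, init E p = v) -> w = v.
Proof.
move=> fd qT initE; have [ts _] := fd.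
(* The processes of [T] replay one round only: everything sent to them is delayed past [2 * Delta].
   The others replay long enough to decide. *)
pose lvl (j : vproc) : nat := if j.2 then if j.1 \in T then 1%N else 3%N else 0%N.
have [] := @replay_execution R n V P f Delta (fun _ => T) (fun _ => E) Delta_gt0
  (fun _ => ts) set0 lvl (fun _ => false) (fun _ _ => true) _ _ _ _ _ _
  (fun j => j.2) (fun _ _ _ => true).
- by [].
- by move=> j r _ _; rewrite /lvl /=; case: ifP.
- by move=> j r _ _ /= rT; rewrite /lvl /= (negPf rT).
- by move=> [q' b] /= nb; rewrite /lvl /= (negPf nb).
- by move=> [q' b] /= nb; rewrite /lvl /= (negPf nb).
- by [].
- by rewrite cards0.
- by move=> [q' b] /= ->; rewrite /lvl /=; case: ifP.
- by [].
- by exists 0%N.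
move=> E' [adm bE iE decE]; have [_ _ _ validity] := consensus adm.
have [k [s dec]] : exists k s, decides E' q k s w.
  apply/decE; first by rewrite inE.
  exists 0%N; apply: decides_in_replay => //.
  by rewrite /lvl /= (negPf qT).
apply: validity dec; first by rewrite bE.
by move=> p; rewrite iE /replay_input /= initE.
Qed.

Section Influential.
Variables (p : 'I_n) (T : bool -> {set 'I_n}).
Variables (alpha : bool -> execution R n V (data P)) (val : bool -> V).
Hypothesis alpha_fast : forall b, fast_decision (T b) (alpha b) (val b).
Hypothesis alpha_init : forall q b, q != p -> init (alpha b) q = init (alpha false) q.
Hypothesis T_disjoint : forall q, q \in T false -> q \in T true -> False.
Hypothesis p_T : forall b, p \notin T b.
Hypothesis T_nonempty : forall b, exists q, q \in T b.

Lemma fast_two_step b : two_step_execution f Delta (T b) (alpha b).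
Proof. by have [] := alpha_fast b. Qed.

Lemma T_other b q : q \in T b -> q \notin T (~~ b).
Proof.
by move=> qT; apply/negP; move: qT; case: b => /= h1 h2; apply: T_disjoint; eassumption.
Qed.

Lemma T_neq b q : q \in T b -> (q == p) = false.
Proof. by move=> qT; apply/negP => /eqP eqp; move: (p_T b); rewrite -eqp qT. Qed.

(* With no other processes, the Byzantine process [p] equivocates, so that
   [T true] runs as in [alpha false] and [T false] as in [alpha true]. *)
Lemma influential_pair : (1 <= f)%N ->
  (forall q, [|| q == p, q \in T false | q \in T true]) -> val false = val true.
Proof.
move=> f_gt0 cover.
(* The real [p] replays [alpha false], its phantom [alpha true]; the processes of [T c] replay
   [alpha (~~ c)], where they are not silent. Each hears the version of [p] that fits its view. *)
pose lvl (j : vproc) : nat := if j.1 == p then 2%N else if j.2 then 3%N else 0%N.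
pose view (j : vproc) := if j.1 == p then ~~ j.2 else j.1 \in T false.
pose flag (j : vproc) (r : 'I_n) := if r == p then ~~ view j else true.
have [] := @replay_execution R n V P f Delta T alpha Delta_gt0 fast_two_step [set p] lvl view flag
  _ _ _ _ _ _ (fun j => j.2 && (j.1 != p)) (fun _ _ _ => true).
- move=> j r _ _; rewrite /flag; case: (eqVneq r p) => [->|rp].
    by rewrite {1}/view /= eqxx negbK.
  by rewrite alpha_init // [RHS]alpha_init.
- by move=> j r _ _; rewrite /flag /lvl /=; case: (eqVneq r p).
- move=> j r jT; rewrite {1}/lvl; case: (eqVneq j.1 p) => // jp _.
  rewrite /flag; case: (eqVneq r p) => [-> _|rp rT].
    by rewrite {1}/view /lvl /= eqxx negbK.
  rewrite /lvl /= (negPf rp); split=> //; move: rT.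
  rewrite /view /= (negPf rp) (negPf jp); have := cover r; rewrite (negPf rp) /=.
  by case: (j.1 \in T false) => [/orP[|->]|_ /negPf].
- by move=> [q b] /= nb; rewrite /lvl /= (negPf nb) inE; case: eqP.
- move=> [q b] /= nb; rewrite /lvl /= (negPf nb); case: eqP => // -> _.
  by split=> //; exact: p_T.
- by move=> r b; rewrite inE; exact: alpha_init.
- by rewrite cards1.
- by move=> [q b] /= /andP[-> qp]; rewrite /lvl /= (negPf qp).
- by move=> q; rewrite inE.
- by exists 0%N.
move=> E [adm bE iE decE]; have [_ _ cons _] := consensus adm.
have dec b q : q \in T (~~ b) -> exists k s, decides E q k s (val b).
  move=> qT; have qp := T_neq qT; apply/decE; first by rewrite inE qp.
  have viewE : view (q, true) = b.
    rewrite /view /= qp; case: b qT => /= [//|qT].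
    by apply/negP => qF; exact: T_disjoint qF qT.
  exists 0%N; apply: decides_in_replay => //; rewrite ?viewE //.
    by have := T_other qT; rewrite negbK.
  by rewrite /lvl /= qp.
have [q0 q0T] := T_nonempty true; have [q1 q1T] := T_nonempty false.
have [k0 [s0 dec0]] := dec false q0 q0T; have [k1 [s1 dec1]] := dec true q1 q1T.
by apply: cons dec0 dec1; rewrite bE inE ?(T_neq q0T) ?(T_neq q1T).
Qed.

(** * The case of nonempty groups *)

Section Groups.
Variables (G : bool -> {set 'I_n}) (B : {set 'I_n}).
Hypothesis G_card : forall b, (#|G b| < f)%N.
Hypothesis B_card : (#|B| < f)%N.
Hypothesis B_nonempty : exists q, q \in B.
Hypothesis cover : forall q,
  [|| q == p, q \in B, q \in T false, q \in T true, q \in G false | q \in G true].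
Hypothesis B_T : forall b q, q \in B -> q \notin T b.
Hypothesis B_p : p \notin B.
Hypothesis G_T : forall b c q, q \in G b -> q \notin T c.
Hypothesis G_B : forall b q, q \in G b -> q \notin B.
Hypothesis G_disjoint : forall q, q \in G false -> q \in G true -> False.
Hypothesis G_p : forall b, p \notin G b.

(** The execution replayed by a core process: [T b] belongs to side [~~ b], since it is silent in
    [alpha b], and [G b] to side [b]. *)
Definition side (q : 'I_n) : bool := (q \in T false) || (q \in G true).

Lemma side_T b q : q \in T b -> side q = ~~ b.
Proof.
rewrite /side; case: b => qT /=; last by rewrite qT.
apply/negP => /orP[h|/G_T h]; first exact: T_disjoint h qT.
by move: (h true); rewrite qT.
Qed.

Lemma side_G b q : q \in G b -> side q = b.
Proof.
rewrite /side; case: b => qG /=; first by rewrite qG orbT.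
apply/negP => /orP[h|h]; last exact: G_disjoint qG h.
by move: (G_T false qG); rewrite h.
Qed.

Definition core (j : vproc) : bool := [&& j.2, j.1 != p & j.1 \notin B].

(* The middle execution: [p] and [B] are Byzantine and silent after the first
   round, and every core process runs as on its own side. *)
Definition middle_lvl (j : vproc) : nat :=
  if core j then 2%N else if j.2 || (j.1 == p) then 1%N else 0%N.
Definition middle_view (j : vproc) : bool :=
  if j.1 == p then ~~ j.2 else if j.1 \in B then false else side j.1.
Definition middle_flag (j : vproc) (r : 'I_n) : bool :=
  if r == p then ~~ middle_view j else true.

(* The execution of side [b]: [p] and [G (~~ b)] are Byzantine and show [B] the
   behaviour of [alpha b], while everything else happens as in the middle
   execution until round [N]. *)
Variable b : bool.
Definition outer_lvl (j : vproc) : nat :=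
  if j.2 then if j.1 \in B then 3%N else 2%N
  else if (j.1 == p) || (j.1 \in G (~~ b)) then 2%N else 0%N.
Definition outer_view (j : vproc) : bool :=
  if j.1 == p then ~~ j.2 else
  if j.1 \in B then b else if j.2 then side j.1 else b.
Definition outer_flag (j : vproc) (r : 'I_n) : bool :=
  if r == p then ~~ outer_view j else ~~ ((j.1 \in B) && (r \in G (~~ b))).

(** [core] consists precisely of the correct processes here, so restricting deliveries to [core] is
    fair from the start. *)
Lemma middle_execution : exists E : execution R n V (data P),
  [/\ admissible f Delta E, byz E = p |: B
    & forall q v, q \notin p |: B -> (exists k s, decides E q k s v) <->
        (exists r, decides_in (replay_input alpha middle_view)
           (stage (replay_input alpha middle_view) Delta (2 * Delta)
             (replay Delta_gt0 fast_two_step middle_lvl middle_view middle_flag)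
             core (fun _ a j => core a && core j) r) q v)].
Proof.
have [] := @replay_execution R n V P f Delta T alpha Delta_gt0 fast_two_step (p |: B)
  middle_lvl middle_view middle_flag _ _ _ _ _ _ core (fun _ a j => core a && core j).
- move=> j r _ _; rewrite /middle_flag; case: (eqVneq r p) => [->|rp].
    by rewrite {1}/middle_view /= eqxx negbK.
  by rewrite alpha_init // [RHS]alpha_init.
- move=> j r _ _; rewrite /middle_flag /middle_lvl /=.
  by case: (eqVneq r p) => [->|_]; case: ifP => //; rewrite ?eqxx ?orbT.
- by move=> j r _; rewrite {1}/middle_lvl; case: ifP => // _; case: ifP.
- move=> [q c] /= nc; rewrite /middle_lvl /core /= (negPf nc) /= !inE.
  by case: (eqVneq q p).
- by move=> [q c] /= nc; rewrite /middle_lvl /core /= (negPf nc) /=; case: eqP.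
- by move=> r c; rewrite !inE negb_or => /andP[rp _]; exact: alpha_init.
- by rewrite cardsU1 B_p add1n.
- by move=> j cj; rewrite /middle_lvl cj andbT; case/and3P: cj.
- by move=> q; rewrite !inE negb_or.
- exists 0%N => r [q c] q' _ /= -> qF qF'; move: qF qF'; rewrite !inE !negb_or.
  by rewrite /core /= => -> ->.
by move=> E [adm bE _ decE]; exists E.
Qed.

(** The real members of [G (~~ b)] keep behaving as in the middle execution; only their phantoms
    face [B]. Withholding all messages to and from [B] until round [N] is allowed by partial
    synchrony. *)
Lemma outer_execution N : exists E : execution R n V (data P),
  [/\ admissible f Delta E, byz E = p |: G (~~ b)
    & forall q v, q \notin p |: G (~~ b) -> (exists k s, decides E q k s v) <->
        (exists r, decides_in (replay_input alpha outer_view)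
           (stage (replay_input alpha outer_view) Delta (2 * Delta)
             (replay Delta_gt0 fast_two_step outer_lvl outer_view outer_flag)
             (fun j => j.2 && (j.1 != p))
             (fun r a j => core a && core j || (N <= r)%N) r) q v)].
Proof.
have [] := @replay_execution R n V P f Delta T alpha Delta_gt0 fast_two_step (p |: G (~~ b))
  outer_lvl outer_view outer_flag _ _ _ _ _ _ (fun j => j.2 && (j.1 != p))
  (fun r a j => core a && core j || (N <= r)%N).
- move=> j r _ _; rewrite /outer_flag; case: (eqVneq r p) => [->|rp].
    by rewrite {1}/outer_view /= eqxx negbK.
  by rewrite alpha_init // [RHS]alpha_init.
- move=> j r _ _; rewrite /outer_flag /outer_lvl /=.
  case: (eqVneq r p) => [->|rp]; first by case: ifP => //; case: ifP.
  by case: (j.1 \in B); case: (r \in G (~~ b)); case: (r \in B).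
- move=> [q c] r /= -> {c}; rewrite {1}/outer_lvl /=; case: ifP => // qB _.
  have qp : (q == p) = false by apply/negP => /eqP qp; move: B_p; rewrite -qp qB.
  have -> : outer_view (q, true) = b by rewrite /outer_view /= qp qB.
  move=> rT; rewrite /outer_flag /= /outer_view /= qp qB /=.
  case: (eqVneq r p) => [->|rp] /=.
    by rewrite negbK /outer_lvl /= eqxx; case: (~~ b) => //; case: (p \in B).
  rewrite /outer_lvl /= ?(negPf rp) /=; case rG: (r \in G (~~ b)) => /=.
    by split=> //; case: (r \in B).
  split; last by case: ifP.
  case: ifP => // rB; have := cover r; rewrite (negPf rp) rB /=.
  move: rT rG; case: (b) => /= rT rG; rewrite ?(negPf rT) ?rG /= ?orbF.
    by case/orP=> [/side_T|/side_G].
  by case/orP=> [/side_T|/side_G].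
- by move=> [q c] /= nc; rewrite /outer_lvl /= (negPf nc) !inE; case: ifP.
- move=> [q c] /= nc; rewrite /outer_lvl /= (negPf nc); case: ifP => // /orP h _.
  split=> //; first by case: ifP.
  case: h => [/eqP->|qG]; first exact: p_T.
  exact: G_T qG.
- by move=> r c; rewrite !inE negb_or => /andP[rp _]; exact: alpha_init.
- by rewrite cardsU1 G_p add1n; exact: G_card.
- by move=> [q c] /= /andP[-> _]; rewrite /outer_lvl /=; case: ifP.
- by move=> q; rewrite !inE negb_or => /andP[].
- by exists N => r j q leN _ _ _; rewrite leN orbT.
by move=> E [adm bE _ decE]; exists E.
Qed.

(** On [core] the two constructions have the same views, levels and attributions, and they deliver
    the same messages before round [N]. *)
Lemma core_agree N q : core (q, true) ->
  replay_input alpha middle_view (q, true) = replay_input alpha outer_view (q, true) /\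
  stage (replay_input alpha middle_view) Delta (2 * Delta)
    (replay Delta_gt0 fast_two_step middle_lvl middle_view middle_flag)
    core (fun _ a j => core a && core j) N (q, true) =
  stage (replay_input alpha outer_view) Delta (2 * Delta)
    (replay Delta_gt0 fast_two_step outer_lvl outer_view outer_flag)
    (fun j => j.2 && (j.1 != p)) (fun r a j => core a && core j || (N <= r)%N)
    N (q, true).
Proof.
move=> cq; have viewE j : core j -> middle_view j = outer_view j.
  by case/and3P=> j2 jp jB; rewrite /middle_view /outer_view (negPf jp) (negPf jB) j2.
have inpE j : core j -> replay_input alpha middle_view j = replay_input alpha outer_view j.
  by move=> cj; rewrite /replay_input viewE.
split; first exact: inpE.
apply: (@stage_agree R n V P _ _ _ core N) => //.
- move=> j cj; have flagE : middle_flag j = outer_flag j.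
    apply/funext => r; rewrite /middle_flag /outer_flag viewE //.
    by case/and3P: cj => _ _ /negPf->.
  have lvlE : middle_lvl j = outer_lvl j.
    by rewrite /middle_lvl cj /outer_lvl; case/and3P: cj => -> _ /negPf->.
  by rewrite /replay flagE lvlE viewE.
- by move=> j cj; case/and3P: (cj) => -> -> _; rewrite cj.
- by move=> r a j _ _ /andP[].
- by move=> r a j ltN _; rewrite leqNgt ltN orbF.
Qed.

(** The decision of [q] carries over to the outer execution, where [q] is still correct, while a
    member of [B] decides [val b] by time [2 * Delta]. Consistency equates the two. *)
Lemma outer_decision N q v : q \in T false ->
  decides_in (replay_input alpha middle_view)
    (stage (replay_input alpha middle_view) Delta (2 * Delta)
      (replay Delta_gt0 fast_two_step middle_lvl middle_view middle_flag)
      core (fun _ a j => core a && core j) N) q v -> v = val b.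
Proof.
move=> qT dec; have qp := T_neq qT.
have qB : q \notin B by apply/negP => /(B_T false); rewrite qT.
have cq : core (q, true) by rewrite /core /= qp qB.
have [E [adm bE decE]] := outer_execution N.
have [_ _ cons _] := consensus adm; have [x xB] := B_nonempty.
have xp : (x == p) = false by apply/negP => /eqP xp; move: B_p; rewrite -xp xB.
have qF : q \notin p |: G (~~ b).
  rewrite !inE qp /=; apply/negP => /(G_T false); by rewrite qT.
have xF : x \notin p |: G (~~ b).
  by rewrite !inE xp /=; apply/negP => /G_B; rewrite xB.
have [k [s dec1]] : exists k s, decides E q k s v.
  apply/decE => //; exists N; move: dec; rewrite /decides_in.
  by have [-> ->] := core_agree N cq.
have [k' [s' dec2]] : exists k s, decides E x k s (val b).
  have viewE : outer_view (x, true) = b by rewrite /outer_view /= xp xB.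
  apply/decE => //; exists 0%N.
  apply: decides_in_replay; rewrite ?viewE //; first exact: B_T.
  by rewrite /outer_lvl /= xB.
by apply: cons dec1 dec2; rewrite bE.
Qed.

End Groups.
End Influential.
End LowerBound.

(** * Subsets of given size and the silent sets of the walk *)

Lemma subset_of_card (U : finType) (S : {set U}) k : (k <= #|S|)%N ->
  exists2 A : {set U}, A \subset S & #|A| = k.
Proof.
move=> lek; exists [set x in take k (enum S)].
  by apply/subsetP => x; rewrite inE => /mem_take; rewrite mem_enum.
rewrite cardsE (card_uniqP _) ?take_uniq ?enum_uniq //.
by rewrite size_takel // -cardE.
Qed.

Section Chain.
Variables (n t : nat).
Hypothesis n_gt : (2 * t < n)%N.

Let n_gt0 : (0 < n)%N. Proof. exact: leq_ltn_trans (leq0n _) n_gt. Qed.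

(* [comb i] consists of the offsets 1, 3, ..., 2t - 1 from [i], hence [comb i.+1]
   of the offsets 2, 4, ..., 2t, and none of these is 0 modulo [n]. *)
Definition comb (i : nat) : {set 'I_n} :=
  [set Ordinal (ltn_pmod (i + (2 * s).+1) n_gt0) | s : 'I_t].

Lemma shift_eq i a b : (a < n)%N -> (b < n)%N ->
  ((i + a) %% n = (i + b) %% n)%N -> a = b.
Proof.
by move=> an bn /eqP; rewrite eqn_modDl !modn_small // => /eqP.
Qed.

Lemma card_comb i : #|comb i| = t.
Proof.
rewrite card_imset ?card_ord // => s s' /(congr1 val) /= /shift_eq eq_s.
by apply: val_inj => /=; have := ltn_ord s; have := ltn_ord s'; lia.
Qed.

Lemma comb_disjoint i q : q \in comb i -> q \in comb i.+1 -> False.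
Proof.
move=> /imsetP[s _ ->] /imsetP[s' _ /(congr1 val)] /=; rewrite addSnnS => /shift_eq.
by have := ltn_ord s; have := ltn_ord s'; lia.
Qed.

Lemma comb_notin i (ltn : (i < n)%N) : Ordinal ltn \notin comb i.
Proof.
apply/negP => /imsetP[s _ /(congr1 val)] /=.
rewrite -{1}(modn_small ltn) -{1}[i]addn0 => /shift_eq.
by have := ltn_ord s; lia.
Qed.

Lemma comb_notinS i (ltn : (i < n)%N) : Ordinal ltn \notin comb i.+1.
Proof.
apply/negP => /imsetP[s _ /(congr1 val)] /=.
rewrite addSnnS -{1}(modn_small ltn) -{1}[i]addn0 => /shift_eq.
by have := ltn_ord s; lia.
Qed.

End Chain.

(** * Existence of an influential process and the final contradiction *)

Section Main.
Variables (R : realType) (n : nat) (V : Type) (P : protocol R n V).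
Variables (f t : nat) (Delta : R).
Hypothesis Delta_gt0 : 0 < Delta.
Hypothesis t_gt0 : (0 < t)%N.
Hypothesis P_two_step : two_step_consensus P f t Delta.

Lemma influential_process (x y : V) : x <> y -> (2 * t < n)%N ->
  exists (p : 'I_n) (T : bool -> {set 'I_n})
      (alpha : bool -> execution R n V (data P)) (val : bool -> V),
  [/\ forall b, fast_decision f Delta (T b) (alpha b) (val b),
      forall q b, q != p -> init (alpha b) q = init (alpha false) q,
      forall q, q \in T false -> q \in T true -> False,
      forall b, (p \notin T b) && (#|T b| == t)
    & val false <> val true].
Proof.
move=> neq_xy n_gt; have [consensus two_step] := P_two_step.
(* Configurations [I i] and [I i.+1] differ only at process [i], which lies in neither of the
   disjoint sets [T i] and [T i.+1]. *)
pose I i (q : 'I_n) := if (q < i)%N then y else x.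
pose T := comb n_gt.
have fast_ex i : exists (E : execution R n V (data P)) v, init E = I i /\ fast_decision f Delta (T i) E v.
  have [E [iE ts]] := two_step (I i) (T i) (card_comb n_gt i).
  have [q qT] : exists q, q \notin T i.
    apply: contrapT => none; have all_in q : q \in T i.
      by apply: contrapT => /negP qT; apply: none; exists q.
    have : #|[set: 'I_n]| = t.
      rewrite -(card_comb n_gt i); apply: eq_card => q; rewrite inE.
      by rewrite all_in.
    by rewrite cardsT card_ord; lia.
  by have [v fd] := fast_decision_exists consensus ts qT; exists E, v.
have outside i : (i < n)%N -> exists q, q \notin T i.
  by move=> ltn; exists (Ordinal ltn); exact: comb_notin.
apply: contrapT => none.
(* Weak validity gives the value [x] at the all-[x] configuration. Without an influential process it
   persists along the walk to the all-[y] configuration, contradicting weak validity there. *)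
have chain i : (i <= n)%N -> exists2 E : execution R n V (data P), init E = I i & fast_decision f Delta (T i) E x.
  elim: i => [_|i IH ltn].
    have [E [v [iE fd]]] := fast_ex 0%N; exists E => //.
    have n0 : (0 < n)%N by lia.
    have [q qT] := outside 0%N n0.
    by rewrite -(fast_validity Delta_gt0 consensus (v := x) fd qT) // => p; rewrite iE.
  have [E iE fd] := IH (ltnW ltn); have [E' [v [iE' fd']]] := fast_ex i.+1.
  have [->|neq] := pselect (x = v); first by exists E'.
  case: none; exists (Ordinal ltn), (fun b => T (if b then i.+1 else i)).
  exists (fun b => if b then E' else E), (fun b => if b then v else x).
  split=> //; first by case.
  - move=> q [] // qi; rewrite iE iE' /I ltnS leq_eqVlt.
    by case: eqP => // eqi; case/eqP: qi; apply: val_inj.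
  - by move=> q; exact: comb_disjoint.
  - by case; rewrite card_comb eqxx andbT; [exact: comb_notinS|exact: comb_notin].
have [E iE fd] := chain n (leqnn n).
have [q qT] : exists q, q \notin T n.
  have n0 : (n.-1 < n)%N by lia.
  exists (Ordinal n0); have := comb_notinS n_gt n0.
  by rewrite prednK //; lia.
apply: neq_xy; apply: (fast_validity Delta_gt0 consensus fd qT) => p.
by rewrite iE /I ltn_ord.
Qed.

Lemma no_two_step (x y : V) : x <> y -> (t <= f)%N ->
  n = (3 * f.-1 + 2 * t).+1 -> False.
Proof.
move=> neq_xy t_le_f n_eq; have [consensus _] := P_two_step.
have [|p [T [alpha [val [fast initE T_disj pT neq_val]]]]] := influential_process neq_xy.
  by rewrite n_eq; lia.
have p_T b : p \notin T b by have /andP[] := pT b.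
have card_T b : #|T b| = t by have /andP[_ /eqP] := pT b.
have T_ne b : exists q, q \in T b.
  by apply/set0Pn; rewrite -card_gt0 card_T.
(* Removing [p] and two disjoint sets of size [t] leaves exactly [3 * f.-1] processes, enough for
   three groups of size [f.-1]. *)
pose rest := ~: (p |: (T false :|: T true)).
have card_rest : #|rest| = (3 * f.-1)%N.
  have TT : T false :&: T true = set0.
    apply/setP => q; rewrite !inE; apply/negP => /andP[]; exact: T_disj.
  have := cardsC (p |: (T false :|: T true)); rewrite -/rest card_ord cardsU1.
  rewrite cardsU TT cards0 !card_T !inE !(negPf (p_T _)) /=; move: n_eq; lia.
have restP q : (q \in rest) = [&& q != p, q \notin T false & q \notin T true].
  by rewrite !inE !negb_or.
have [|A A_sub cardA] := @subset_of_card _ rest f.-1; first by rewrite card_rest; lia.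
have cardRA : #|rest :\: A| = (2 * f.-1)%N.
  by rewrite cardsD (setIidPr A_sub) card_rest cardA; lia.
have [|C C_sub cardC] := @subset_of_card _ (rest :\: A) f.-1; first by rewrite cardRA; lia.
pose B := (rest :\: A) :\: C.
have cardB : #|B| = f.-1 by rewrite cardsD (setIidPr C_sub) cardRA cardC; lia.
(* For f = 1 there is no member of [B] to decide early, but then [rest] is empty and the
   equivocation of [p] alone suffices. *)
have [f1|f_gt1] := leqP f 1.
  apply: neq_val; apply: (influential_pair Delta_gt0 consensus fast initE) => //.
    exact: leq_trans t_le_f.
  move=> q; have : q \notin rest.
    have /eqP : #|rest| = 0%N by rewrite card_rest; lia.
    by rewrite cards_eq0 => /eqP->; rewrite inE.
  by rewrite restP !negb_and !negbK.
pose G (b : bool) := if b then C else A.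
have CP q : q \in C -> (q \in rest) && (q \notin A).
  by move/(subsetP C_sub); rewrite inE andbC.
have G_rest b q : q \in G b -> q \in rest.
  by case: b => /= [/CP/andP[]//|]; exact: (subsetP A_sub).
have B_rest q : q \in B -> q \in rest by rewrite !in_setD => /and3P[].
have rest_T b q : q \in rest -> q \notin T b.
  by rewrite restP => /and3P[_ h1 h2]; case: b.
have G_card b : (#|G b| < f)%N by case: b; rewrite /= ?cardA ?cardC; lia.
have G_disj q : q \in G false -> q \in G true -> False.
  by move=> /= qA /CP/andP[_]; rewrite qA.
have G_B b q : q \in G b -> q \notin B.
  by case: b => /= h; rewrite !in_setD h ?andbF.
have p_rest : p \notin rest by rewrite restP eqxx.
have B_ne : exists q, q \in B by apply/set0Pn; rewrite -card_gt0 cardB; lia.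
have cover q : [|| q == p, q \in B, q \in T false, q \in T true, q \in G false | q \in G true].
  rewrite !in_setD restP /=; case: (q == p) => //=.
  by case: (q \in T false); case: (q \in T true); case: (q \in A); case: (q \in C).
have B_card : (#|B| < f)%N by rewrite cardB; lia.
have B_T b q : q \in B -> q \notin T b by move/B_rest; exact: rest_T.
have G_T b c q : q \in G b -> q \notin T c by move/G_rest; exact: rest_T.
have B_p : p \notin B by apply: contra p_rest; exact: B_rest.
have G_p b : p \notin G b by apply: contra p_rest; exact: G_rest.
have [q qT] := T_ne false.
have [E [adm bE decE]] := middle_execution Delta_gt0 fast initE G B_card B_p.
have [live _ _ _] := consensus _ adm.
have qF : q \notin p |: B.
  rewrite in_setU1 negb_or; apply/andP; split.
    by apply: contraNneq (p_T false) => <-.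
  by apply/negP => /(B_T false); rewrite qT.
have [k [s [v dec]]] : exists k s v, decides E q k s v by apply: live; rewrite bE.
(* [N] is a round by which [q] has decided in the middle execution. Both outer executions are
   delayed until this round, so the same [v] equals [val false] and [val true]. *)
have [N decN] := (decE q v qF).1 (ex_intro _ k (ex_intro _ s dec)).
have valE b : v = val b.
  exact: (outer_decision consensus initE T_disj p_T G_card B_ne cover B_T B_p
    G_T G_B G_disj G_p b qT decN).
by apply: neq_val; rewrite -!valE.
Qed.

End Main.

Theorem theorem4p5 (R : realType) (V : Type) (f t : nat) (Delta : R)
  (V_two : exists x y : V, x <> y)
  (t_ge1 : (1 <= t)%N) (t_le_f : (t <= f)%N) (Delta_gt0 : 0 < Delta) :
  ~ exists P : protocol R (3 * f + 2 * t - 2)%N V,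
      two_step_consensus P f t Delta.
Proof.
case: V_two => x [y neq_xy] [P P_two_step].
apply: (no_two_step Delta_gt0 t_ge1 P_two_step neq_xy t_le_f).
(* As f and t are positive, the truncated subtraction is exact and 3f + 2t - 2 = 3(f - 1) + 2t +
   1. *)
by lia.
Qed.
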